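(* Let $k,\alpha>0$, $\gamma,\omega\in\mathbb{R}$, $\mu\in(0,1)$ with $\mu<k$, and $\nu\in[0,1]$. Let $f\in AC^{1}[0,b]$ for every $b>0$ be such that the Sumudu transforms of $f$ and of the regularized $k$-Hilfer-Prabhakar derivative ${}_{k}^{C}\mathcal{D}_{\alpha,\omega,0^{+}}^{\gamma,\mu,\nu}f$ exist, and let $F(u)=\mathcal{S}[f](u)$. Then, for $u>0$ with $\left|\omega k\left(\frac uk\right)^{\alpha/k}\right|<1$, $$\mathcal{S}\big({}_{k}^{C}\mathcal{D}_{\alpha,\omega,0^{+}}^{\gamma,\mu,\nu}f(t)\big)(u)=\Big(\frac{u}{k}\Big)^{-\frac{\mu}{k}}\Big(1-\omega k\Big(\frac{u}{k}\Big)^{\frac{\alpha}{k}}\Big)^{\frac{\gamma}{k}}\big(F(u)-f(0^{+})\big).$$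
   Context: The Sumudu transform is $\mathcal{S}[f](u)=\int_0^\infty\frac1u e^{-t/u}f(t)\,dt$, considered for functions $f$ in the set $A$ of functions for which there are $M,\tau_1,\tau_2>0$ with $|f(t)|\le Me^{|t|/\tau_j}$ for $t\in(-1)^j\times[0,\infty)$, and $u\in(-\tau_1,\tau_2)$; here $u>0$. $AC^{1}[0,b]$ is the set of real-valued absolutely continuous functions on $[0,b]$. The $k$-gamma function is $\Gamma_k(z)=\int_0^\infty e^{-t^k/k}t^{z-1}\,dt$ for $\operatorname{Re}z>0$, and the $k$-Pochhammer symbol is $(\gamma)_{n,k}=\gamma(\gamma+k)\cdots(\gamma+(n-1)k)$, $(\gamma)_{0,k}=1$. The $k$-Mittag-Leffler function is $E_{k,\alpha,\mu}^{\gamma}(z)=\sum_{n=0}^\infty \frac{(\gamma)_{n,k}}{\Gamma_k(\alpha n+\mu)}\frac{z^n}{n!}$. The $k$-Prabhakar integral (for $\operatorname{Re}\alpha,\operatorname{Re}\mu>0$) is $$\big({}_{k}P_{\alpha,\mu,\omega}^{\gamma}f\big)(x)=\big({}_{k}P_{\alpha,\mu,\omega,0^+}^{\gamma}f\big)(x)=\int_0^x\frac{(x-t)^{\frac{\mu}{k}-1}}{k}E_{k,\alpha,\mu}^{\gamma}\big[\omega(x-t)^{\frac{\alpha}{k}}\big]f(t)\,dt ,$$ with the convention that ${}_{k}P_{\alpha,0,\omega}^{0}$ is the identity. The regularized $k$-Hilfer-Prabhakar fractional derivative is $${}_{k}^{C}\mathcal{D}_{\alpha,\omega,0^{+}}^{\gamma,\mu,\nu}f(t)=k\Big({}_{k}P_{\alpha,\nu(k-\mu),\omega,0^{+}}^{-\gamma\nu}\,{}_{k}P_{\alpha,(1-\nu)(k-\mu),\omega,0^{+}}^{-\gamma(1-\nu)}\frac{d}{dt}f\Big)(t),$$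 which also equals $k\big({}_{k}P_{\alpha,k-\mu,\omega,0^{+}}^{-\gamma}\frac{d}{dt}f\big)(t)$. *)

(* Defs.v *)
From HB Require Import structures.
From mathcomp Require Import all_boot all_order all_algebra.
From mathcomp Require Import all_classical all_reals all_analysis.

Set Implicit Arguments.
Unset Strict Implicit.
Unset Printing Implicit Defensive.

Import Order.TTheory GRing.Theory Num.Theory.
Import numFieldNormedType.Exports.

Local Open Scope classical_set_scope.
Local Open Scope ring_scope.

(* The classical epsilon-delta definition, over finite families of pairwise
   disjoint open subintervals of [a, b]. *)
Definition absolutely_continuous (R : realType) (a b : R) (f : R -> R) : Prop :=
  forall e : R, 0 < e -> exists2 d : R, 0 < d &
    forall (n : nat) (l r : 'I_n -> R),
      (forall i, [/\ a <= l i, l i < r i & r i <= b]) ->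
      trivIset [set: 'I_n] (fun i => `]l i, r i[%classic) ->
      \sum_(i < n) (r i - l i) < d ->
      \sum_(i < n) `|f (r i) - f (l i)| < e.

Definition sumudu (R : realType) (f : R -> R) (u : R) : R :=
  \int[lebesgue_measure]_(t in `[0, +oo[) (u^-1 * expR (- t / u) * f t).

(* Absolute convergence of the defining integral. A measurable f satisfying
   |f t| <= M e^(t / tau) for all t >= 0 has this property for 0 < u < tau. *)
Definition sumudu_exists (R : realType) (f : R -> R) (u : R) : Prop :=
  lebesgue_measure.-integrable `[0, +oo[
    (fun t : R => (u^-1 * expR (- t / u) * f t)%:E).

Definition kGamma (R : realType) (k z : R) : R :=
  \int[lebesgue_measure]_(t in `]0, +oo[) (expR (- (t `^ k) / k) * t `^ (z - 1)).

Definition kpochhammer (R : realType) (k gamma : R) (n : nat) : R :=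
  \prod_(i < n) (gamma + i%:R * k).

Definition kMittagLeffler (R : realType) (k alpha mu gamma z : R) : R :=
  limn (series (fun n : nat =>
    kpochhammer k gamma n / kGamma k (alpha * n%:R + mu) * (z ^+ n / n`!%:R))).

(* The first branch is the convention that the operator with mu = 0 and
   gamma = 0, whose integral form is undefined, is the identity. *)
Definition kPrabhakar (R : realType) (k alpha mu omega gamma : R)
    (f : R -> R) (x : R) : R :=
  if (mu == 0) && (gamma == 0) then f x else
  \int[lebesgue_measure]_(t in `[0, x])
    ((x - t) `^ (mu / k - 1) / k *
     kMittagLeffler k alpha mu gamma (omega * (x - t) `^ (alpha / k)) * f t).

(* derive1 f is the pointwise derivative; for absolutely continuous f it is the
   usual one almost everywhere and takes a junk value on the remaining null
   set, which does not affect the integrals. *)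
Definition kHilferPrabhakar (R : realType) (k alpha omega gamma mu nu : R)
    (f : R -> R) (t : R) : R :=
  k * kPrabhakar k alpha (nu * (k - mu)) omega (- (gamma * nu))
        (kPrabhakar k alpha ((1 - nu) * (k - mu)) omega (- (gamma * (1 - nu)))
           (derive1 f)) t.

(* Main.v *)
Require Import Defs.
From HB Require Import structures.
From mathcomp Require Import all_boot all_order all_algebra.
From mathcomp Require Import all_classical all_reals all_analysis.
From mathcomp Require Import measurable_realfun.
From mathcomp Require Import ring lra.

(** The Sumudu transform at [u] is [p] times the Laplace transform at
    [p = 1 / u], so the claim is about Laplace transforms. A k-Prabhakar operator
    with order m and upper parameter c is the convolution on the half-line with
    the kernel K(x) = x^(m/k - 1) / k * E(omega x^(alpha/k)) ([mlKernel]). Integrating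
    the series of K term by term produces values of the k-gamma function that
    cancel the denominators of E, and what remains is a binomial series: the
    transform of K is (k p)^(-m/k) (1 - q)^(-c/k) with
    q = omega k (u/k)^(alpha/k) ([has_laplace_mlKernel]). The transforms of the
    two kernels of the derivative multiply to the factor in the theorem, because
    their parameters m and c add up to k - mu and - gamma. The operator with
    m = c = 0, which is the identity, fits the same formula.

    Only f and its fractional derivative D are assumed to have a transform; the
    derivative f' may grow too fast to have one. The convolution theorem is
    therefore applied after one integration. Integration commutes with
    convolutions ([primitive_volterra]), so the primitive of D is k K1 * (K2 * phi)
    with phi = f - f(0), where every factor has a transform. On the other side
    the primitive of D is the convolution of D with the constant 1 and its
    transform is that of D divided by p ([has_laplace_primitive]). Comparing the
    two gives the formula.

    This needs f(x) - f(0) to be the integral of f' over [0, x], which is the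
    fundamental theorem of calculus for absolutely continuous functions
    ([absolutely_continuous_FTC]). It is obtained by writing f as a difference of
    two nondecreasing absolutely continuous functions, by means of the total
    variation; the Stieltjes measure of such a function is dominated by the
    Lebesgue measure and has a Radon-Nikodym density, and by the Lebesgue
    differentiation theorem the difference of the densities is f' almost
    everywhere. *)

Set Implicit Arguments.
Unset Strict Implicit.
Unset Printing Implicit Defensive.

Import Order.TTheory GRing.Theory Num.Theory.
Import numFieldNormedType.Exports.

Local Open Scope classical_set_scope.
Local Open Scope ring_scope.

(** * Families of intervals and total variation *)

Section IntervalFamilies.
Variable R : realType.
Implicit Types (a b e : R) (f g G : R -> R) (p q : R * R) (s : seq (R * R)).

Definition nonoverlapping p q : bool := (p.2 <= q.1) || (q.2 <= p.1).

(** Families are lists, so that one of the intervals can be traded for the cells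
    of a partition of it. *)
Definition interval_family a b s : bool :=
  all (fun p => [&& a <= p.1, p.1 < p.2 & p.2 <= b]) s &&
  pairwise nonoverlapping s.

Definition total_length s : R := \sum_(p <- s) (p.2 - p.1).

Definition oscillation G s : R := \sum_(p <- s) `|G p.2 - G p.1|.

Definition family_ac a b G : Prop := forall e, 0 < e -> exists2 d : R, 0 < d &
  forall s, interval_family a b s -> total_length s < d -> oscillation G s <= e.

Lemma absolutely_continuous_family a b f :
  absolutely_continuous a b f -> family_ac a b f.
Proof.
move=> ac e e0; have [d d0 Hd] := ac e e0; exists d => // s /andP[/allP s1 s2].
rewrite /total_length /oscillation => ltd; apply/ltW.
pose l (i : 'I_(size s)) := (nth (0, 0) s i).1.
pose r (i : 'I_(size s)) := (nth (0, 0) s i).2.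
have := Hd (size s) l r.
rewrite /l /r.
rewrite (big_nth (0, 0)) big_mkord in ltd.
rewrite (big_nth (0, 0)) big_mkord; apply => //.
  by move=> i; have /and3P[] := s1 _ (mem_nth (0, 0) (ltn_ord i)).
apply/trivIsetP => i j _ _ ij.
wlog lij : i j ij / (i < j)%N.
  move=> W; have [lij|lij|/val_inj eij] := ltngtP i j.
  - exact: W.
  - by rewrite setIC; apply: W => //; rewrite eq_sym.
  - by rewrite eij eqxx in ij.
have := @pairwiseP _ nonoverlapping (0, 0) s.
move=> /elimT /(_ s2 i j (ltn_ord i) (ltn_ord j) lij) /orP[] le12.
- apply/seteqP; split=> // x [] /=; rewrite !in_itv/= => /andP[_ h1] /andP[h2 _].
  by have := lt_le_trans h1 (le_trans le12 (ltW h2)); rewrite ltxx.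
- apply/seteqP; split=> // x [] /=; rewrite !in_itv/= => /andP[h1 _] /andP[_ h2].
  by have := lt_le_trans h2 (le_trans le12 (ltW h1)); rewrite ltxx.
Qed.

Definition partition_cells (x : R) (t : seq R) : seq (R * R) := pairmap pair x t.

Lemma partition_cells_length (x y : R) (t : seq R) : itv_partition x y t ->
  total_length (partition_cells x t) = y - x.
Proof.
rewrite /total_length; elim: t x => [|z t IH] x /=.
  by move=> /itv_partition_nil ->; rewrite big_nil subrr.
by move=> xyt; rewrite big_cons (IH _ (itv_partition_cons xyt)) /= addrC subrKA.
Qed.

Lemma partition_cells_oscillation (x y : R) f (t : seq R) : itv_partition x y t ->
  oscillation f (partition_cells x t) = variation x y f t.
Proof.
rewrite /oscillation; elim: t x => [|z t IH] x.
  by rewrite /variation /= !big_nil.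
move=> xyt; rewrite big_cons (IH _ (itv_partition_cons xyt)) /=.
by rewrite /variation/= big_nat_recl.
Qed.

Lemma partition_cells_family (x y : R) (t : seq R) : itv_partition x y t ->
  interval_family x y (partition_cells x t).
Proof.
elim: t x => [|z t IH] x //= xyt.
have xz : x < z by case: xyt => /= /andP[].
have zyt := itv_partition_cons xyt.
have zy := itv_partition_le zyt.
have /andP[/allP h1 h2] := IH _ zyt.
rewrite /interval_family /= lexx xz zy h2 /= andbT; apply/andP; split.
  by apply/allP => p /h1 /and3P[h ->->]; rewrite (le_trans (ltW xz) h).
by apply/allP => p /h1 /and3P[h _ _]; rewrite /nonoverlapping /= h.
Qed.

Lemma interval_family_cat a b s (t : seq (R * R)) : interval_family a b (s ++ t) =
  [&& interval_family a b s, interval_family a b t & allrel nonoverlapping s t].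
Proof.
rewrite /interval_family all_cat pairwise_cat.
case: (all _ s) => //=; case: (all _ t) => //=; last by rewrite andbF.
by rewrite [in RHS]andbA andbC.
Qed.

Lemma interval_family_refine a b p (t : seq R) s : itv_partition p.1 p.2 t ->
  interval_family a b (p :: s) -> interval_family a b (partition_cells p.1 t ++ s).
Proof.
move=> /partition_cells_family/andP[/allP ht1 ht2].
rewrite interval_family_cat /interval_family /= => /andP[/andP[pab ->]].
move=> /andP[/allP ps ->]; rewrite ht2 !andbT /=.
move: pab => /and3P[ap pp pb]; apply/andP; split.
  apply/allP => q /ht1/and3P[h1 h2 h3].
  by rewrite (le_trans ap h1) h2 (le_trans h3 pb).
apply/allrelP => q r /ht1/and3P[h1 h2 h3] /ps.
by rewrite /nonoverlapping => /orP[h|h]; [rewrite (le_trans h3 h)|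
  rewrite (le_trans h h1) orbT].
Qed.

Lemma oscillation_cat G s1 s2 :
  oscillation G (s1 ++ s2) = oscillation G s1 + oscillation G s2.
Proof. by rewrite /oscillation big_cat. Qed.

(** By induction on [s1]: the total variation over the first interval is the
    supremum over its partitions, and the cells of a partition can be moved to
    [s2]. *)
Lemma total_variation_refine a b f d e :
  (forall s, interval_family a b s -> total_length s < d -> oscillation f s <= e) ->
  forall s1 s2, interval_family a b (s1 ++ s2) -> total_length (s1 ++ s2) < d ->
  (\sum_(p <- s1) total_variation p.1 p.2 f + (oscillation f s2)%:E <= e%:E)%E.
Proof.
move=> H; elim=> [|p s IH] t fam len.
  by rewrite big_nil add0e lee_fin; exact: H.
have pp : p.1 < p.2 by move: fam => /andP[/= /andP[/and3P[]]].
have p2 : 0 <= p.2 - p.1 by rewrite subr_ge0 ltW.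
have fam' : interval_family a b (s ++ t).
  by move: fam; rewrite /interval_family /= => /andP[/andP[_ ->] /andP[_ ->]].
have len' : total_length (s ++ t) < d.
  by apply: le_lt_trans len; rewrite /total_length /= big_cons lerDr.
rewrite big_cons -addeA.
set B := (X in (_ + X <= _)%E).
have finB : B \is a fin_num.
  rewrite ge0_fin_numE; first exact: le_lt_trans (IH _ fam' len') (ltry _).
  apply: adde_ge0; last by rewrite lee_fin; apply: sumr_ge0.
  rewrite big_seq; apply: sume_ge0 => q qs; apply: total_variation_ge0.
  move: fam' => /andP[/allP /(_ q)].
  by rewrite mem_cat qs => /(_ isT)/and3P[_ /ltW].
rewrite -leeBrDr//; apply: ge_ereal_sup => _ [_ [u pu] <- <-].
rewrite leeBrDr// -(partition_cells_oscillation f pu).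
have := IH (partition_cells p.1 u ++ t).
rewrite oscillation_cat EFinD /B addeCA; apply.
  have := interval_family_refine pu fam.
  rewrite !interval_family_cat !allrel_catr.
  move=> /and3P[-> /and3P[-> -> ->] /andP[h ->]]; rewrite !andbT /=.
  by apply/allrelP => q r qs rp; have := allrelP h r q rp qs;
    rewrite /nonoverlapping orbC.
move: len; rewrite /= /total_length big_cons !big_cat/=.
have := partition_cells_length pu; rewrite /total_length => ->.
by rewrite addrCA.
Qed.

Lemma family_ac_total_variation a b f : family_ac a b f ->
  forall e, 0 < e -> exists2 d : R, 0 < d & forall s, interval_family a b s ->
    total_length s < d -> (\sum_(p <- s) total_variation p.1 p.2 f <= e%:E)%E.
Proof.
move=> ac e e0; have [d d0 Hd] := ac e e0; exists d => // s fam len.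
have := @total_variation_refine a b f d e Hd s [::].
by rewrite cats0 /oscillation big_nil adde0; apply.
Qed.

Lemma interval_family1 a b (x y : R) : interval_family a b [:: (x, y)] =
  [&& a <= x, x < y & y <= b].
Proof. by rewrite /interval_family /= !andbT. Qed.

(** Intervals of length [d / 2] have total variation at most 1, and finitely many
    of them cover [[a, b]]. *)
Lemma family_ac_bounded_variation a b f : a <= b -> family_ac a b f ->
  bounded_variation a b f.
Proof.
move=> ab /family_ac_total_variation /(_ 1 ltr01)[d d0 Hd].
apply/bounded_variationP => //.
have step n x : a <= x -> x <= b -> x <= a + n%:R * (d / 2) ->
    total_variation a x f \is a fin_num.
  elim: n x => [|n IH] x ax xb.
    rewrite mul0r addr0 => xa; have -> : x = a by apply/eqP; rewrite eq_le xa ax.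
    by rewrite total_variationxx.
  rewrite -natr1 mulrDl mul1r addrA => xn.
  (* One step to the left, but not beyond a. *)
  pose y := Num.max a (x - d / 2).
  have ay : a <= y by rewrite le_max lexx.
  have yx : y <= x by rewrite ge_max ax /=; lra.
  rewrite (total_variationD _ ay yx) fin_numD IH//; last 2 first.
  - exact: le_trans yx xb.
  - by rewrite ge_max; apply/andP; split; [rewrite lerDl mulr_ge0//; lra|lra].
  move: yx; rewrite le_eqVlt => /predU1P[->|yx]; first by rewrite total_variationxx.
  rewrite ge0_fin_numE; last exact/total_variation_ge0/ltW.
  have := Hd [:: (y, x)]; rewrite interval_family1 ay yx xb /total_length !big_seq1.
  move=> /(_ isT) h; apply: (le_lt_trans _ (ltry 1)); apply: h => /=.
  have : x - d / 2 <= y by rewrite le_max lexx orbT.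
  lra.
pose n := Num.bound ((b - a) / (d / 2)).
apply: (step n) => //.
have /ltW : (b - a) / (d / 2) < n%:R.
  by apply: archi_boundP; rewrite divr_ge0//; lra.
by rewrite ler_pdivrMr; [lra|lra].
Qed.

Section MonotoneParts.
Variables (a b : R) (f : R -> R) (ab : a <= b) (ac : family_ac a b f).

Let V x : R := fine (total_variation a x f).

Let fin x y : a <= x -> x <= y -> y <= b -> total_variation x y f \is a fin_num.
Proof.
move=> ax xy yb; apply/bounded_variationP => //.
have bv := family_ac_bounded_variation ab ac.
by apply: bounded_variationr (bounded_variationl (le_trans ax xy) yb bv).
Qed.

Let VB x y : a <= x -> x <= y -> y <= b ->
  V y - V x = fine (total_variation x y f).
Proof.
move=> ax xy yb; rewrite /V (total_variationD f ax xy) fineD ?fin//.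
  by rewrite addrAC subrr add0r.
exact: le_trans xy yb.
Qed.

Let normV x y : a <= x -> x <= y -> y <= b -> `|f y - f x| <= V y - V x.
Proof.
move=> ax xy yb; rewrite VB// -lee_fin fineK ?fin//.
exact: total_variation_ge.
Qed.

(** [G1] is the total variation from [a], and [G2] is [G1 - f]. *)
Lemma family_ac_monotone_parts : exists G1 G2 : R -> R,
  [/\ {in `[a, b] &, {homo G1 : x y / x <= y}},
      {in `[a, b] &, {homo G2 : x y / x <= y}},
      family_ac a b G1, family_ac a b G2 & forall x, f x = G1 x - G2 x].
Proof.
have acV : family_ac a b V.
  move=> e e0; have [d d0 Hd] := family_ac_total_variation ac e0.
  exists d => // s fam len; have := Hd s fam len.
  rewrite -lee_fin; apply: le_trans.
  rewrite /oscillation -sumEFin big_seq [leRHS]big_seq.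
  apply: lee_sum => p ps; move: fam => /andP[/allP /(_ p ps)/and3P[h1 /ltW h2 h3]] _.
  rewrite ger0_norm VB// ?fineK ?fin//.
  by rewrite fine_ge0// total_variation_ge0.
exists V, (fun x => V x - f x); split => //.
- move=> x y; rewrite !in_itv/= => /andP[ax xb] /andP[ay yb] xy.
  by rewrite -subr_ge0 (le_trans _ (normV ax xy yb)).
- move=> x y; rewrite !in_itv/= => /andP[ax xb] /andP[ay yb] xy.
  rewrite -subr_ge0; have := normV ax xy yb; have := ler_norm (f y - f x).
  lra.
- move=> e e0.
  have [d1 d10 H1] := acV (e / 2) ltac:(by rewrite divr_gt0).
  have [d2 d20 H2] := ac (e := e / 2) ltac:(by rewrite divr_gt0).
  exists (Num.min d1 d2) => [|s fam]; first by rewrite lt_min d10.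
  rewrite lt_min => /andP[l1 l2]; rewrite (splitr e).
  apply: le_trans (lerD (H1 s fam l1) (H2 s fam l2)).
  rewrite /oscillation -big_split /=; apply: ler_sum => p _.
  rewrite (_ : _ - _ - _ = (V p.2 - V p.1) - (f p.2 - f p.1)); last by ring.
  exact: ler_normB.
- by move=> x; rewrite subKr.
Qed.

End MonotoneParts.
End IntervalFamilies.

(** * Densities of monotone absolutely continuous functions *)

Section AbsolutelyContinuousMeasure.
Variable R : realType.
Local Notation leb := (@lebesgue_measure R).

(** Finiteness of the measure excludes unbounded intervals. *)
Lemma open_interval_bounds (A : set R) :
  open A -> is_interval A -> A !=set0 -> (leb A < +oo)%E ->
  exists p : R * R, [/\ p.1 < p.2, `]p.1, p.2[ `<=` A, A `<=` `]p.1, p.2] &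
    leb A = (p.2 - p.1)%:E].
Proof.
move=> oA iA [z Az] muA.
have EA : A = [set` Rhull A] by rewrite RhullK// inE.
case E : (Rhull A) EA => [[x l|x] [y r|y]] EA.
- have Alr w : A w -> l <= w <= r.
    move=> Aw.
    have : [set` Interval (BSide x l) (BSide y r)] `<=` `[l, r].
      by apply: subset_itv; rewrite bnd_simp; [case: x E EA|case: y E EA].
    by move=> /(_ w); rewrite -EA => /(_ Aw); rewrite /= in_itv.
  have interior w : A w -> l < w < r.
    move=> Aw; move: (oA); rewrite openE => /(_ w Aw)[e /= e0 He].
    have /Alr : A (w + e / 2).
      by apply: He; rewrite /ball/= opprD addNKr normrN gtr0_norm; lra.
    have /Alr : A (w - e / 2) by apply: He; rewrite /ball/= subKr gtr0_norm; lra.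
    by move=> /andP[? _] /andP[_ ?]; apply/andP; split; lra.
  have lr : l < r by have /andP[h1 h2] := interior z Az; exact: lt_trans h1 h2.
  exists (l, r) => /=; split => //.
  + by rewrite EA; apply: subset_itv; rewrite bnd_simp; [case: x E EA|case: y E EA].
  + by move=> w /interior/andP[h1 /ltW h2]; rewrite /= in_itv/= h1.
  + by rewrite EA lebesgue_measure_itv/= lte_fin lr.
- move: muA; rewrite EA lebesgue_measure_itv/=; case: y E EA => E EA.
    by move: Az; rewrite EA /= in_itv/= andbF.
  by rewrite ltry.
- move: muA; rewrite EA lebesgue_measure_itv/=; case: x E EA => E EA.
    by rewrite ltNyr.
  by move: Az; rewrite EA /= in_itv/=.
- move: muA; rewrite EA lebesgue_measure_itv/=; case: x E EA => E EA; case: y E EA => E EA;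
    try (by move: Az; rewrite EA /= in_itv/= ?andbF).
Qed.

Section StieltjesDensity.
Variables (a b : R) (G : R -> R) (ab : a <= b).
Hypotheses (ndG : {in `[a, b] &, {homo G : x y / x <= y}}) (acG : family_ac a b G).

Let clamp x := Num.min b (Num.max a x).

Let clamp_in x : clamp x \in `[a, b].
Proof. by rewrite in_itv/= /clamp le_min ab ge_min !le_max !lexx. Qed.

Let clamp_nd x y : x <= y -> clamp x <= clamp y.
Proof.
move=> xy; rewrite /clamp.
have h : Num.max a x <= Num.max a y by rewrite ge_max !le_max lexx xy orbT.
by rewrite le_min !ge_min lexx h orbT.
Qed.

Let clamp_lip x y : x <= y -> clamp y - clamp x <= y - x.
Proof.
move=> xy; rewrite /clamp.
case: (ltP a x) => ?; case: (ltP a y) => ?.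
- by case: (ltP b x) => ?; case: (ltP b y) => ?; lra.
- lra.
- by case: (ltP b a) => ?; case: (ltP b y) => ?; lra.
- by case: (ltP b a) => ?; lra.
Qed.

Let clampK x : x \in `[a, b] -> clamp x = x.
Proof.
by rewrite in_itv/= => /andP[ax xb]; rewrite /clamp (max_idPr ax) (min_idPr xb).
Qed.

(** Extending [G] by constants outside [[a, b]] makes its Stieltjes measure
    finite. *)
Let C x := G (clamp x).

Let ndC : {homo C : x y / x <= y}.
Proof. by move=> x y xy; apply: ndG => //; exact: clamp_nd. Qed.

Let rcC x : C t @[t --> x^'+] --> C x.
Proof.
apply/cvgrPdist_le => e e0; have [d d0 Hd] := acG e0.
near=> t.
have xt : x < t by near: t; exact: nbhs_right_gt.
have td : t < x + d by near: t; apply: nbhs_right_lt; rewrite ltrDl.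
rewrite distrC; have := clamp_nd (ltW xt); rewrite le_eqVlt => /predU1P[E|lt].
  by rewrite /C E subrr normr0 ltW.
have := Hd [:: (clamp x, clamp t)].
rewrite interval_family1 lt /total_length /oscillation !big_seq1/=.
have := clamp_in x; have := clamp_in t; rewrite !in_itv/= => /andP[_ ->] /andP[-> _].
apply => //; apply: le_lt_trans (clamp_lip (ltW xt)) _; lra.
Unshelve. all: by end_near. Qed.

Let Cc : cumulative R R := HB.pack C (isCumulative.Build R _ R C ndC rcC).

Let nu : {measure set (measurableTypeR R) -> \bar R} := lebesgue_stieltjes_measure Cc.

Let nu_oc x y : x <= y -> nu `]x, y]%classic = (C y - C x)%:E.
Proof.
move=> xy; transitivity ((wlength Cc)^*%mu `]x, y]%classic) => //.
rewrite measurable_mu_extE; last exact: is_ocitv.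
exact: wlength_itv_bnd.
Qed.

Let nu_fin : (nu setT < +oo)%E.
Proof.
apply: (@le_lt_trans _ _ (G b - G a)%:E); last exact: ltry.
  have Tcup : [set: R] = \bigcup_n `](- n%:R), n%:R]%classic.
    apply/esym; rewrite -subTset => x _; exists (Num.bound `|x|) => //=.
    by have := archi_boundP (normr_ge0 x); have := ler_norm x; have := ler_norm (- x); rewrite normrN in_itv/=; set N := _%:R => ? ? ?; apply/andP; split; lra.
  have cvg : nu `](- n%:R), n%:R]%classic @[n --> \oo] --> nu setT.
    rewrite Tcup; apply: nondecreasing_cvg_mu.
    - by move=> n; exact: measurable_itv.
    - by apply: bigcupT_measurable => n; exact: measurable_itv.
    - move=> m n mn; apply/subsetPset; apply: subset_itv; rewrite bnd_simp.
        by rewrite lerN2 ler_nat.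
      by rewrite ler_nat.
  rewrite -(cvg_lim _ cvg)//; apply: lime_le.
    by apply/cvg_ex; exists (nu setT).
  apply: nearW => n; rewrite nu_oc; last by rewrite (le_trans (y := 0))// oppr_le0.
  rewrite lee_fin lerB// ndG ?in_itv/= ?lexx ?ab ?andbT//.
  1-4: have := clamp_in n%:R; have := clamp_in (- n%:R); rewrite !in_itv/=.
  1-4: by move=> /andP[h1 h2] /andP[h3 h4]; rewrite ?h1 ?h2 ?h3 ?h4.
Qed.

Let nuf : {finite_measure set (measurableTypeR R) -> \bar R} :=
  mfrestr measurableT nu_fin.

Let nufE A : nuf A = nu A.
Proof. by rewrite /nuf /= /mfrestr /mrestr setIT. Qed.

(** A null set lies in an open set of small Lebesgue measure. The open set is a
    countable union of disjoint intervals, and absolute continuity bounds the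
    increments of [G] over every finite subfamily of them. *)
Let nu_dom : nuf `<< leb.
Proof.
apply/null_content_dominatesP => N mN muN; apply/eqP; rewrite eq_le measure_ge0 andbT.
rewrite nufE; apply/lee_addgt0Pr => e e0; rewrite add0e.
have [d d0 Hd] := acG e0.
have muNfin : (leb N < +oo)%E by rewrite muN.
have [U [oU NU muU]] := lebesgue_regularity_outer mN muNfin d0.
have {}muU : (leb U < d%:E)%E.
  apply: le_lt_trans muU; rewrite -[leRHS]adde0 -muN.
  have -> : leb U = leb ((U `\` N) `|` N) by rewrite setDKU.
  apply: measureU2 => //; apply: measurableD => //; exact: open_measurable.
apply: (@le_trans _ _ (nu U)).
  by apply: le_measure => //; rewrite inE//; exact: open_measurable.
pose A := open_disjoint_itv oU.
have mA i : measurable (A i) by apply: open_measurable; exact: open_disjoint_itv_open.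
have tA : trivIset [set: nat] A by exact: open_disjoint_itv_trivIset.
have UE : U = \bigcup_q A q by exact: open_disjoint_itv_bigcup.
have AU i : A i `<=` U by rewrite UE; exact: bigcup_sup.
have muA i : (leb (A i) < +oo)%E.
  apply: le_lt_trans (lt_trans muU (ltry d)).
  by apply: le_measure; [rewrite inE; exact: mA|rewrite inE; exact: open_measurable|exact: AU].
have /choice[p Hp] : forall i, exists p : R * R, A i !=set0 ->
    [/\ p.1 < p.2, `]p.1, p.2[ `<=` A i, A i `<=` `]p.1, p.2] &
    leb (A i) = (p.2 - p.1)%:E].
  move=> i; have [A0|] := pselect (A i !=set0); last by exists (0, 0).
  have [p Hp] := open_interval_bounds (@open_disjoint_itv_open _ _ oU i)
    (@open_disjoint_itv_is_interval _ _ oU i) A0 (muA i).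
  by exists p.
pose P i := `[< A i !=set0 >] && (clamp (p i).1 < clamp (p i).2).
pose s m := [seq (clamp (p i).1, clamp (p i).2) | i <- iota 0 m & P i].
have fam m : interval_family a b (s m).
  apply/andP; split.
    apply/allP => q /mapP[i + ->]; rewrite mem_filter => /andP[/andP[_ lti] _] /=.
    have := clamp_in (p i).1; have := clamp_in (p i).2.
    by rewrite !in_itv/= lti => /andP[_ ->] /andP[-> _].
  rewrite pairwise_map.
  have : pairwise ltn (seq.filter P (iota 0 m)).
    by apply: pairwise_filter; rewrite -sorted_pairwise; [exact: iota_ltn_sorted|exact: ltn_trans].
  apply: sub_in_pairwise (allss _) => i j.
  rewrite !mem_filter => /andP[/andP[/asboolP Ai _] _] /andP[/andP[/asboolP Aj _] _] ij.
  have [pi iA _ _] := Hp i Ai; have [pj jA _ _] := Hp j Aj.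
  rewrite /nonoverlapping/=.
  have [h|h] := leP (p i).2 (p j).1; first by rewrite clamp_nd.
  have [h'|h'] := leP (p j).2 (p i).1; first by rewrite (clamp_nd h') orbT.
  exfalso; move/trivIsetP : tA => /(_ i j Logic.I Logic.I).
  rewrite ltn_eqF// => /(_ erefl); apply/eqP/set0P.
  pose l := Num.max (p i).1 (p j).1; pose r := Num.min (p i).2 (p j).2.
  have lr : l < r by rewrite lt_min !gt_max pi pj h h'.
  have l1 : (p i).1 <= l by rewrite le_max lexx.
  have l2 : (p j).1 <= l by rewrite le_max lexx orbT.
  have r1 : r <= (p i).2 by rewrite ge_min lexx.
  have r2 : r <= (p j).2 by rewrite ge_min lexx orbT.
  exists ((l + r) / 2); split; [apply: iA|apply: jA]; rewrite /= in_itv/=; apply/andP; split; lra.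
have len m : total_length (s m) < d.
  rewrite -lte_fin; apply: le_lt_trans muU.
  rewrite UE measure_semi_bigcup//; last exact: bigcupT_measurable.
  apply: (@le_trans _ _ (\sum_(0 <= i < m) leb (A i))%E); last first.
    by apply: nneseries_lim_ge => i _ _; exact: measure_ge0.
  rewrite /total_length big_map big_filter -sumEFin big_mkcond/= /index_iota subn0.
  apply: lee_sum => i _.
  case: ifPn => [/andP[/asboolP Ai _]|_]; last exact: measure_ge0.
  by have [pi _ _ ->] := Hp i Ai; rewrite lee_fin clamp_lip// ltW.
have osc m : (\sum_(0 <= i < m) nu (A i) <= (oscillation G (s m))%:E)%E.
  rewrite /oscillation big_map big_filter -sumEFin [leRHS]big_mkcond/= /index_iota subn0.
  apply: lee_sum => i _; rewrite /P.
  have [Ai|/set0P/negP/negPn/eqP ->] := pselect (A i !=set0); last first.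
    by rewrite measure0; case: ifP => //=; rewrite lee_fin.
  have [pi _ iA _] := Hp i Ai; rewrite asboolT//=.
  have le1 : (nu (A i) <= (C (p i).2 - C (p i).1)%:E)%E.
    rewrite -nu_oc ?(ltW pi)//; apply: le_measure; [rewrite inE; exact: mA|rewrite inE; exact: measurable_itv|exact: iA].
  apply: (le_trans le1).
  case: ifPn => [_|]; first by rewrite lee_fin ler_norm.
  rewrite -leNgt => h; have Ec : clamp (p i).2 = clamp (p i).1.
    by apply/eqP; rewrite eq_le h clamp_nd// ltW.
  by rewrite /C Ec subrr.
rewrite UE measure_semi_bigcup//; last exact: bigcupT_measurable.
apply: lime_le; first by apply: is_cvg_nneseries => i _ _; exact: measure_ge0.
apply: nearW => m.
by apply: le_trans (osc m) _; rewrite lee_fin; exact: Hd.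
Qed.

(** [h] is the Radon-Nikodym density of the Stieltjes measure of [G]. *)
Lemma monotone_ac_density : exists h : R -> R,
  leb.-integrable [set: R] (EFin \o h) /\
  forall x, a <= x <= b -> G x - G a = \int[leb]_(t in `]a, x]) h t.
Proof.
have [h [h0 hfin hint hnu]] := radon_nikodym_sigma_finite nu_dom.
have hE : EFin \o (fine \o h) = h by apply/funext => x /=; rewrite fineK.
exists (fine \o h); rewrite hE; split => // x /andP[ax xb].
have := hnu `]a, x]%classic (measurable_itv _).
rewrite nufE nu_oc// /C !clampK ?in_itv/= ?lexx ?ax ?ab ?xb// /Rintegral.
by under [X in _ -> _ = fine X]eq_integral do rewrite /= fineK//; move=> <-.
Qed.

End StieltjesDensity.
End AbsolutelyContinuousMeasure.

(** * The fundamental theorem of calculus *)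

Section FundamentalTheorem.
Variable R : realType.
Local Notation leb := (@lebesgue_measure R).

(** [h] is the difference of the densities of the two monotone parts of [f]; the
    Lebesgue differentiation theorem identifies it with the derivative. *)
Theorem absolutely_continuous_FTC (a b : R) (f : R -> R) :
  a <= b -> absolutely_continuous a b f ->
  exists h : R -> R,
  [/\ leb.-integrable [set: R] (EFin \o h),
      forall x, a <= x <= b -> f x - f a = \int[leb]_(t in `]a, x]) h t &
      {ae leb, forall x, a < x < b -> derive1 f x = h x}].
Proof.
move=> ab /absolutely_continuous_family ac.
have [G1 [G2 [nd1 nd2 ac1 ac2 fE]]] := family_ac_monotone_parts ab ac.
have [h1 [int1 H1]] := monotone_ac_density ab nd1 ac1.
have [h2 [int2 H2]] := monotone_ac_density ab nd2 ac2.
have hint : leb.-integrable [set: R] (EFin \o (fun x => h1 x - h2 x)).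
  rewrite (_ : EFin \o _ = (EFin \o h1) \- (EFin \o h2))%E//.
  exact: integrableB.
have HE x : a <= x <= b -> f x - f a = \int[leb]_(t in `]a, x]) (h1 t - h2 t).
  move=> axb; rewrite !fE RintegralB//; last 2 first.
    1-2: exact: integrableS int1 || exact: integrableS int2.
  by rewrite -H1// -H2//; ring.
exists (fun x => h1 x - h2 x); split => //.
have : locally_integrable [set: R] (fun x => h1 x - h2 x).
  by apply: open_integrable_locally => //; exact: openT.
move=> /lebesgue_differentiation; apply: filterS.
  exact: (ae_filter_ringOfSetsType leb).
move=> x xl /andP[ax xb].
have xx1 : x < x + 1 by rewrite ltrDl.
have iax : leb.-integrable [set` `]a, x + 1]] (EFin \o (fun x => h1 x - h2 x)).
  exact: integrableS hint.
have [dF <-] := FTC1_lebesgue_pt xx1 iax ax xl.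
set F := fun y => _ in dF *.
rewrite !derive1E -[RHS]addr0 -(derive_cst (f a) x 1) -deriveD//.
apply: near_eq_derive; near=> y.
have ay : a < y by near: y; exact: lt_nbhsr.
have yb : y < b by near: y; exact: lt_nbhsl.
by rewrite fctE/= /F -HE ?subrK// (ltW ay) ltW.
Unshelve. all: by end_near. Qed.

End FundamentalTheorem.

(** * Almost everywhere equal integrands *)

Section NonmeasurableIntegrand.
Context d (T : measurableType d) (R : realType) (m : {measure set T -> \bar R}).
Implicit Types f g : T -> \bar R.
Local Open Scope ereal_scope.

Import HBNNSimple.

(** The integral of a nonnegative function is by definition the supremum of the
    integrals of the simple functions below it, whether or not the function is
    measurable, and a simple function may be replaced by 0 on [N]. *)
Lemma ae_le_integral_nonneg f g (N : set T) : measurable N -> m N = 0 ->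
  (forall x, 0 <= f x) -> (forall x, 0 <= g x) ->
  (forall x, ~ N x -> f x <= g x) -> \int[m]_x f x <= \int[m]_x g x.
Proof.
move=> mN N0 f0 g0 fg; have mNC := measurableC mN.
rewrite ge0_integralTE// [leRHS]ge0_integralTE//.
apply: ge_ereal_sup => _ [h /= hf <-].
apply: ereal_sup_ubound; exists (proj_nnsfun h mNC) => /=.
  move=> x; rewrite mindicE; case: (boolP (x \in _)) => [|_].
    by rewrite inE /= mulr1 => Nx; exact: le_trans (hf x) (fg _ Nx).
  by rewrite mulr0.
rewrite -!integralT_nnsfun; apply: ge0_ae_eq_integral => //.
- exact/measurable_EFinP.
- exact/measurable_EFinP.
- by move=> x _; rewrite lee_fin.
- by move=> x _; rewrite lee_fin.
exists N; split => // x /= /not_implyP[_].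
apply: contra_notP => Nx; rewrite mindicE mem_set//= mulr1//.
Qed.

(** This exchanges the pointwise derivative, whose measurability is not known
    beforehand, with the density that it equals off a null set. *)
Lemma ae_eq_integral_set (D : set T) f g : ae_eq m D f g ->
  \int[m]_(x in D) f x = \int[m]_(x in D) g x.
Proof.
move=> [N [mN N0 sub]].
have fgN x : ~ N x -> (f \_ D) x = (g \_ D) x.
  move=> Nx; rewrite !patchE; case: ifPn => //; rewrite inE => Dx.
  by have /contrapT/(_ Dx) := contra_not (sub x) Nx.
rewrite integral_mkcond [RHS]integral_mkcond.
rewrite integralE [RHS]integralE; congr (_ - _).
- by apply/eqP; rewrite eq_le; apply/andP; split;
    apply: (ae_le_integral_nonneg mN N0) => // x Nx; rewrite !funeposE fgN.
- by apply/eqP; rewrite eq_le; apply/andP; split;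
    apply: (ae_le_integral_nonneg mN N0) => // x Nx; rewrite !funenegE fgN.
Qed.

End NonmeasurableIntegrand.

(** * Convolution on the line *)

Section Translation.
Variable R : realType.
Local Notation leb := (@lebesgue_measure R).

Let shiftm (s : R) : measurableTypeR R -> measurableTypeR R := fun x => x - s.

Let mshift s : measurable_fun setT (shiftm s).
Proof. by apply: measurable_funB. Qed.

Let shift_pack s : {mfun measurableTypeR R >-> measurableTypeR R} :=
  HB.pack (shiftm s) (isMeasurableFun.Build _ _ _ _ _ (mshift s)).

Lemma lebesgue_measure_translation (s : R) (A : set R) : measurable A ->
  pushforward leb (fun x => x - s) A = leb A.
Proof.
move=> mA; apply/esym.
apply: (@lebesgue_measure_unique R (pushforward leb (shift_pack s))) => //.
move=> _ [[x y] _ <-] /=; rewrite /pushforward.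
rewrite (_ : shiftm s @^-1` _ = `]x + s, y + s]%classic); last first.
  by apply/seteqP; split=> z; rewrite /= !in_itv/= /shiftm ltrBrDr lerBlDr.
by rewrite !lebesgue_measure_itv/= !lte_fin ltrD2r -!EFinD; congr (if _ then _%:E else _);
  ring.
Qed.

Lemma ge0_integral_translation (s : R) (f : R -> \bar R) :
  measurable_fun setT f -> (forall x, 0 <= f x)%E ->
  (\int[leb]_x f (x - s)%R = \int[leb]_x f x)%E.
Proof.
move=> mf f0.
have := @ge0_integral_pushforward _ _ _ _ R _ (mshift s) leb setT f measurableT mf.
rewrite preimage_setT => <- //.
apply: eq_measure_integral => A mA _; exact: lebesgue_measure_translation.
Qed.

Lemma integral_translation (s : R) (f : R -> \bar R) : measurable_fun setT f ->
  (\int[leb]_x f (x - s)%R = \int[leb]_x f x)%E.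
Proof.
move=> mf; rewrite integralE [RHS]integralE; congr (_ - _)%E.
- transitivity (\int[leb]_x f^\+ (x - s)%R)%E.
    by apply: eq_integral => x _; rewrite !funeposE.
  apply: ge0_integral_translation; first exact: measurable_funepos.
  by move=> x; exact: funepos_ge0.
- transitivity (\int[leb]_x f^\- (x - s)%R)%E.
    by apply: eq_integral => x _; rewrite !funenegE.
  apply: ge0_integral_translation; first exact: measurable_funeneg.
  by move=> x; exact: funeneg_ge0.
Qed.

End Translation.

Section Convolution.
Variable R : realType.
Local Notation leb := (@lebesgue_measure R).
Implicit Types a b w : R -> R.

Definition conv a b (x : R) : R := \int[leb]_t (a (x - t) * b t).

(** For [0 < c] the two infinite cases of the positive and the negative part are
    preserved, so that the identity holds for non-integrable functions, where
    convolutions take junk values. *)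
Lemma integral_scale (c : R) (f : R -> \bar R) : 0 < c -> measurable_fun setT f ->
  (\int[leb]_x (c%:E * f x) = c%:E * \int[leb]_x f x)%E.
Proof.
move=> c0 mf; have c0' := ltW c0.
rewrite integralE (ge0_funeposM f c0') (ge0_funenegM f c0').
rewrite !ge0_integralZl_EFin//; last 2 first.
- exact: measurable_funeneg.
- exact: measurable_funepos.
rewrite [in RHS]integralE.
have : (0 <= \int[leb]_x f^\+ x)%E by apply: integral_ge0 => x _; exact: funepos_ge0.
have : (0 <= \int[leb]_x f^\- x)%E by apply: integral_ge0 => x _; exact: funeneg_ge0.
move: (\int[leb]_x f^\- x)%E (\int[leb]_x f^\+ x)%E => [B| |] [A| |] //= _ _;
  rewrite ?(gt0_muley, gt0_muleNy) ?lte_fin//.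
by rewrite -!EFinM -EFinB -mulrBr.
Qed.

Lemma Rintegral_scale (c : R) (f : R -> R) : 0 < c -> measurable_fun setT f ->
  \int[leb]_x (c * f x) = c * \int[leb]_x f x.
Proof.
move=> c0 mf; rewrite /Rintegral.
under eq_integral do rewrite EFinM.
rewrite integral_scale//; last exact/measurable_EFinP.
case: (\int[leb]_x (f x)%:E)%E => //=;
  by rewrite ?(gt0_muley, gt0_muleNy) ?lte_fin// ?mulr0.
Qed.

Let RR := (measurableTypeR R * measurableTypeR R)%type.

Let meas_arg a b w : measurable_fun setT a -> measurable_fun setT b ->
  measurable_fun setT w ->
  measurable_fun [set: RR] (fun z => w z.1 * (a (z.1 - z.2) * b z.2)).
Proof.
move=> ma mb mw.
apply: measurable_funM; first exact: (measurableT_comp mw measurable_fst).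
apply: measurable_funM; last exact: (measurableT_comp mb measurable_snd).
apply: (measurableT_comp ma).
by apply: measurable_funB; [exact: measurable_fst|exact: measurable_snd].
Qed.

Let meas_sum a b w : measurable_fun setT a -> measurable_fun setT b ->
  measurable_fun setT w ->
  measurable_fun [set: RR] (fun z => w (z.1 + z.2) * (a z.1 * b z.2)).
Proof.
move=> ma mb mw.
apply: measurable_funM.
  apply: (measurableT_comp mw).
  by apply: measurable_funD; [exact: measurable_fst|exact: measurable_snd].
apply: measurable_funM; first exact: (measurableT_comp ma measurable_fst).
exact: (measurableT_comp mb measurable_snd).
Qed.

Section Fixed.
Variables a b w : R -> R.
Hypotheses (ia : leb.-integrable setT (EFin \o a))
  (ib : leb.-integrable setT (EFin \o b)).
Hypotheses (mw : measurable_fun setT w) (w1 : forall x, `|w x| <= 1).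

Let ma : measurable_fun setT a.
Proof. by move/integrableP : ia => [/measurable_EFinP]. Qed.

Let mb : measurable_fun setT b.
Proof. by move/integrableP : ib => [/measurable_EFinP]. Qed.

Let finabs f : leb.-integrable setT (EFin \o f) -> (\int[leb]_x `|f x|%:E < +oo)%E.
Proof. by move=> /integrableP[]. Qed.

(** By Tonelli and translation invariance the integral of the absolute value is at
    most the product of the L1 norms. *)
Lemma integrable_conv_kernel : (leb \x leb)%E.-integrable setT
  (fun z : RR => (w z.1 * (a (z.1 - z.2) * b z.2))%:E).
Proof.
have mF : measurable_fun setT (fun z : RR => (w z.1 * (a (z.1 - z.2) * b z.2))%:E).
  by apply/measurable_EFinP; exact: meas_arg.
apply/integrable21ltyP => //.
apply: (@le_lt_trans _ _ (\int[leb]_t (`|b t|%:E * \int[leb]_x `|a x|%:E))%E).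
  apply: ge0_le_integral => //.
  - by move=> t _; apply: integral_ge0 => x _; exact: abse_ge0.
  - apply: (@measurable_fun_fubini_tonelli_G _ _ _ _ R leb
      (fun z : RR => `|(w z.1 * (a (z.1 - z.2) * b z.2))%:E|%E)).
    + exact: measurableT_comp.
    + by move=> z; exact: abse_ge0.
  - apply: emeasurable_funM; last exact: measurable_cst.
    exact/measurable_EFinP/measurableT_comp.
  move=> t _.
  rewrite -(ge0_integral_translation t (f := fun x => `|a x|%:E)); last 2 first.
  - by apply/measurable_EFinP/measurableT_comp.
  - by move=> x; rewrite lee_fin.
  have mat : measurable_fun (setT : set R) (fun x : R => a (x - t)).
    by apply: (measurableT_comp ma); exact: measurable_funB.
  rewrite -ge0_integralZl_EFin//; last first.
  - by apply/measurable_EFinP/measurableT_comp.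
  apply: ge0_le_integral => //.
  - apply/measurable_EFinP/measurableT_comp => //.
    by rewrite /=; apply: measurable_funM => //; apply: measurable_funM => //; exact: measurable_cst.
  - by apply: measurable_funeM; exact/measurable_EFinP/measurableT_comp.
  - move=> x _ /=; rewrite -EFinM lee_fin !normrM (mulrC `|b t|) -[leRHS]mul1r.
    by rewrite ler_wpM2r// mulr_ge0.
apply: (@le_lt_trans _ _ ((\int[leb]_t `|b t|%:E) * \int[leb]_x `|a x|%:E))%E.
  have -> : (\int[leb]_x `|a x|%:E = (fine (\int[leb]_x `|a x|%:E))%:E)%E.
    by rewrite fineK// ge0_fin_numE ?finabs//; apply: integral_ge0.
  rewrite muleC -ge0_integralZl_EFin//; last 2 first.
  - exact/measurable_EFinP/measurableT_comp.
  - by rewrite fine_ge0//; apply: integral_ge0.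
  by under eq_integral do rewrite muleC.
by apply: lte_mul_pinfty; rewrite ?finabs// ?ge0_fin_numE ?finabs//; apply: integral_ge0.
Qed.

Lemma integrable_prod_kernel : (leb \x leb)%E.-integrable setT
  (fun z : RR => (w (z.1 + z.2) * (a z.1 * b z.2))%:E).
Proof.
have m1 : measurable_fun (setT : set R) (fun=> 1 : R) by exact: measurable_cst.
have mF : measurable_fun setT (fun z : RR => (a z.1 * b z.2)%:E).
  have := meas_sum ma mb m1; under eq_fun do rewrite mul1r.
  by move=> h; apply/measurable_EFinP.
have : (leb \x leb)%E.-integrable setT (fun z : RR => (a z.1 * b z.2)%:E).
  apply/integrable12ltyP => //.
  under eq_integral => x _.
    under eq_integral do rewrite /= normrM EFinM.
    rewrite ge0_integralZl_EFin//; last by apply/measurable_EFinP/measurableT_comp.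
    over.
  rewrite /=.
  have -> : (\int[leb]_x `|b x|%:E = (fine (\int[leb]_x `|b x|%:E))%:E)%E.
    by rewrite fineK// ge0_fin_numE ?finabs//; apply: integral_ge0.
  under eq_integral do rewrite muleC.
  rewrite ge0_integralZl_EFin//; last 2 first.
  - exact/measurable_EFinP/measurableT_comp.
  - by rewrite fine_ge0//; apply: integral_ge0.
  by apply: lte_mul_pinfty; rewrite ?finabs// lee_fin fine_ge0//; apply: integral_ge0.
apply: le_integrable => //.
  by apply/measurable_EFinP; exact: meas_sum.
move=> z _ /=; rewrite lee_fin normrM -[leRHS]mul1r ler_wpM2r//.
Qed.

End Fixed.

Section FubiniConv.
Variables a b : R -> R.
Hypotheses (ia : leb.-integrable setT (EFin \o a))
  (ib : leb.-integrable setT (EFin \o b)).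

Let ma : measurable_fun setT a.
Proof. by move/integrableP : ia => [/measurable_EFinP]. Qed.

Let mb : measurable_fun setT b.
Proof. by move/integrableP : ib => [/measurable_EFinP]. Qed.

Let m1 : measurable_fun (setT : set R) (fun=> 1 : R).
Proof. exact: measurable_cst. Qed.

Let kernel1 : (leb \x leb)%E.-integrable setT
  (fun z : RR => (a (z.1 - z.2) * b z.2)%:E).
Proof.
have := @integrable_conv_kernel a b (fun=> 1) ia ib m1.
under eq_fun do rewrite mul1r.
by apply => x; rewrite normr1.
Qed.

Let ae_slice : {ae leb, forall x, leb.-integrable setT
  (fun t => (a (x - t) * b t)%:E)}.
Proof. exact: (ae_integrable1 kernel1). Qed.

Lemma integrable_conv : leb.-integrable setT (EFin \o conv a b).
Proof.
have iF := integrable_fubini_F kernel1.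
apply: le_integrable iF => //.
  apply/measurable_EFinP.
  apply: measurableT_comp => //.
  exact: measurable_fubini_F kernel1.
move=> x _ /=; rewrite /conv /Rintegral /fubini_F /=.
by case: (\int[leb]_t _)%E => //=; rewrite ?normr0 ?leey.
Qed.

(** Fubini, then the translation x = s + t for fixed t, then Fubini again. The
    weight 1 gives the total integral of a convolution, the indicator of an
    interval gives its primitive. *)
Lemma integral_conv_weight (w : R -> R) : measurable_fun setT w ->
  (forall x, `|w x| <= 1) ->
  (\int[leb]_x (w x * conv a b x)%:E =
   \int[leb]_s (a s * \int[leb]_t (w (s + t) * b t))%:E)%E.
Proof.
move=> mw w1.
transitivity (\int[leb]_x \int[leb]_t (w x * (a (x - t) * b t))%:E)%E.
  apply: ae_eq_integral_set; move: ae_slice; apply: filterS.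
    exact: (ae_filter_ringOfSetsType leb).
  move=> x ix _; under [RHS]eq_integral do rewrite EFinM.
  rewrite integralZl// EFinM /conv /Rintegral fineK//.
  exact: integrable_fin_num.
rewrite (Fubini (integrable_conv_kernel ia ib mw w1))/=.
transitivity (\int[leb]_t \int[leb]_s (w (s + t) * (a s * b t))%:E)%E.
  apply: eq_integral => t _.
  rewrite -[RHS](integral_translation t).
    by apply: eq_integral => x _; rewrite subrK.
  apply/measurable_EFinP; apply: measurable_funM.
    by apply: (measurableT_comp mw); exact: measurable_funD.
  by apply: measurable_funM => //; exact: measurable_cst.
rewrite -(Fubini (integrable_prod_kernel ia ib mw w1))/=.
apply: eq_integral => s _.
have iwb : leb.-integrable setT (fun t => (w (s + t) * b t)%:E).
  apply: le_integrable ib => //.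
    apply/measurable_EFinP; apply: measurable_funM => //.
    by apply: (measurableT_comp mw); exact: measurable_funD.
  by move=> t _ /=; rewrite lee_fin normrM -[leRHS]mul1r ler_wpM2r.
under eq_integral do rewrite mulrCA EFinM.
by rewrite integralZl// EFinM /Rintegral fineK//; exact: integrable_fin_num.
Qed.

End FubiniConv.
End Convolution.

(** * Volterra integrals and their Laplace transforms *)

Section Volterra.
Variable R : realType.
Local Notation leb := (@lebesgue_measure R).
Implicit Types (a b : R -> R) (p x y X : R).

Definition volterra a b x : R := \int[leb]_(t in `[0, x]) (a (x - t) * b t).

Definition primitive b x : R := \int[leb]_(t in `[0, x]) b t.

Definition has_laplace p a (L : R) : Prop :=
  leb.-integrable `[0, +oo[ (fun x => (expR (- (p * x)) * a x)%:E) /\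
  \int[leb]_(x in `[0, +oo[) (expR (- (p * x)) * a x) = L.

(** The integral over [[0, x]] sees both functions on [[0, x]] only, so they can be
    cut off to any sets that agree with the half-line up to [x]. *)
Lemma volterra_conv (S S' : set R) a b x :
  (forall y, y <= x -> S y <-> 0 <= y) -> (forall y, y <= x -> S' y <-> 0 <= y) ->
  (forall y, S y -> 0 <= y) -> (forall y, S' y -> 0 <= y) ->
  volterra a b x = conv (a \_ S) (b \_ S') x.
Proof.
move=> HS HS' S0 S0'; rewrite /volterra Rintegral_mkcond /conv.
apply: eq_Rintegral => t _; rewrite !patchE.
case: ifPn => [|/negP]; rewrite inE/= in_itv/=.
  move=> /andP[t0 tx]; rewrite !mem_set//.
  - by apply/HS'.
  - by apply/HS; lra.
move=> h; case: ifPn => [|_]; last by rewrite mul0r.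
rewrite inE => /S0 xt; case: ifPn => [|_]; last by rewrite mulr0.
by rewrite inE => /S0' t0; exfalso; apply: h; apply/andP; split; lra.
Qed.

Lemma volterra_conv_halfline a b x :
  volterra a b x = conv (a \_ `[0, +oo[) (b \_ `[0, +oo[) x.
Proof.
by apply: volterra_conv => y; rewrite /= in_itv/= andbT.
Qed.

Lemma volterra_conv_trunc a b x X : x <= X ->
  volterra a b x = conv (a \_ `[0, X]) (b \_ `[0, X]) x.
Proof.
move=> xX; apply: volterra_conv => y.
1,2: by move=> yx; rewrite /= in_itv/= (le_trans yx xX) andbT.
all: by rewrite /= in_itv/= => /andP[].
Qed.

Lemma eq_volterra a a' b b' x :
  (forall y, 0 <= y <= x -> a y = a' y) -> (forall y, 0 <= y <= x -> b y = b' y) ->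
  volterra a b x = volterra a' b' x.
Proof.
move=> aa bb; apply: eq_Rintegral => t; rewrite inE/= in_itv/= => /andP[t0 tx].
by rewrite aa ?bb ?t0//; apply/andP; split; lra.
Qed.

Let integrable_patch (D : set R) a : measurable D ->
  leb.-integrable D (EFin \o a) -> leb.-integrable setT (EFin \o (a \_ D)).
Proof. by move=> mD; rewrite integrable_mkcond// restrict_EFin. Qed.

Lemma volterra_integrable a b X : leb.-integrable `[0, X] (EFin \o a) ->
  leb.-integrable `[0, X] (EFin \o b) ->
  leb.-integrable `[0, X] (EFin \o volterra a b).
Proof.
move=> ia ib.
have : leb.-integrable `[0, X] (EFin \o conv (a \_ `[0, X]) (b \_ `[0, X])).
  apply: (integrableS measurableT) => //.
  by apply: integrable_conv; apply: integrable_patch.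
apply: eq_integrable => // x; rewrite inE/= in_itv/= => /andP[_ xX].
by rewrite (volterra_conv_trunc _ _ xX).
Qed.

(** Both sides are the integral of a(s) b(t) over the triangle s, t >= 0,
    s + t <= x. *)
Lemma primitive_volterra a b x X : x <= X ->
  leb.-integrable `[0, X] (EFin \o a) -> leb.-integrable `[0, X] (EFin \o b) ->
  primitive (volterra a b) x = volterra (primitive b) a x.
Proof.
move=> xX ia ib.
have mw : measurable_fun setT (\1_`[0, x] : R -> R) by exact: measurable_indic.
have w1 y : `|(\1_`[0, x] : R -> R) y| <= 1.
  by rewrite indicE; case: (_ \in _); rewrite ?normr0 ?normr1.
have := integral_conv_weight (integrable_patch (measurable_itv _) ia)
    (integrable_patch (measurable_itv _) ib) mw w1.
move=> /(congr1 fine).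
have -> : primitive (volterra a b) x =
    \int[leb]_y (\1_`[0, x] y * conv (a \_ `[0, X]) (b \_ `[0, X]) y).
  rewrite /primitive Rintegral_mkcond; apply: eq_Rintegral => y _.
  rewrite patchE indicE; case: ifPn => [|_]; last by rewrite mul0r.
  rewrite inE/= in_itv/= mul1r => /andP[_ yx].
  by rewrite (volterra_conv_trunc _ _ (le_trans yx xX)).
rewrite /Rintegral => ->; rewrite -/(Rintegral _ _ _) /volterra.
rewrite [RHS]Rintegral_mkcond; apply: eq_Rintegral => s _.
rewrite !patchE; case: ifPn => [|/negP]; rewrite inE/= in_itv/=; last first.
  move=> h1; case: ifPn => [|_]; last by rewrite mul0r.
  rewrite inE/= in_itv/= => h2.
  by exfalso; apply: h1; move: h2 => /andP[->]/le_trans; apply.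
move=> /andP[s0 sX].
case: ifPn => [|/negP]; rewrite inE/= in_itv/= s0/=; last first.
  move=> sx; rewrite /Rintegral integral0_eq ?mulr0// => t _.
  rewrite indicE patchE.
  case: (boolP (s + t \in `[0, x]%classic)) => [|_]; last by rewrite mul0r.
  rewrite inE/= in_itv/= => /andP[_ stx].
  case: ifPn => [|_]; last by rewrite mulr0.
  by rewrite inE/= in_itv/= => /andP[t0 _]; exfalso; apply: sx; lra.
move=> sx; rewrite mulrC; congr (_ * _).
rewrite /primitive Rintegral_mkcond; apply: eq_Rintegral => t _.
rewrite indicE !patchE.
case: (boolP (t \in `[0, x - s]%classic)) => [|/negP]; rewrite inE/= in_itv/=.
  move=> /andP[t0 txs]; rewrite !mem_set/= ?mul1r ?in_itv//=; apply/andP; split; lra.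
move=> h; case: (boolP (s + t \in `[0, x]%classic)) => [|_]; last by rewrite mul0r.
rewrite inE/= in_itv/= => /andP[_ h1].
case: ifPn => [|_]; last by rewrite mulr0.
rewrite inE/= in_itv/= => /andP[h2 _].
by exfalso; apply: h; apply/andP; split; lra.
Qed.

Let expE p a : EFin \o ((fun x => expR (- (p * x)) * a x) \_ `[0, +oo[) =
  (fun x => (expR (- (p * x)) * (a \_ `[0, +oo[) x)%:E).
Proof.
by apply/funext => x; rewrite /= !patchE; case: ifPn => // _; rewrite mulr0.
Qed.

Lemma has_laplaceT p a L : has_laplace p a L <->
  leb.-integrable setT (fun x => (expR (- (p * x)) * (a \_ `[0, +oo[) x)%:E) /\
  \int[leb]_x (expR (- (p * x)) * (a \_ `[0, +oo[) x) = L.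
Proof.
rewrite -expE -restrict_EFin -integrable_mkcond//.
rewrite /has_laplace Rintegral_mkcond.
suff -> : (fun x => expR (- (p * x)) * a x) \_ `[0, +oo[ =
  (fun x => expR (- (p * x)) * (a \_ `[0, +oo[) x) by [].
by apply/funext => x; rewrite /= !patchE; case: ifPn => // _; rewrite mulr0.
Qed.

(** A factor exp(-px) distributes over convolution, which leaves the total
    integral of the convolution of two integrable functions. *)
Theorem has_laplace_volterra p a b La Lb :
  has_laplace p a La -> has_laplace p b Lb ->
  has_laplace p (volterra a b) (La * Lb).
Proof.
move=> /has_laplaceT[ia iaE] /has_laplaceT[ib ibE].
set A := a \_ _ in ia iaE; set B := b \_ _ in ib ibE.
pose e x := expR (- (p * x)).
have mexp q : measurable_fun (setT : set R) (fun x => expR (q * x)).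
  by apply: measurableT_comp => //; exact: measurable_funM.
have meas c : leb.-integrable setT (fun x => (e x * c x)%:E) ->
    measurable_fun setT c.
  move=> /integrableP[/measurable_EFinP mc _].
  have := measurable_funM (mexp p) mc; congr measurable_fun; apply/funext => x /=.
  by rewrite mulrA -expRD addrN expR0 mul1r.
have mA := meas A ia; have mB := meas B ib.
have VE : (volterra a b) \_ `[0, +oo[ = conv A B.
  apply/funext => x; rewrite patchE; case: ifPn => [_|/negP].
    exact: volterra_conv_halfline.
  rewrite inE/= in_itv/= andbT => x0; rewrite /conv /Rintegral integral0_eq// => t _.
  rewrite /A /B !patchE; case: ifPn => [|_]; last by rewrite mul0r.
  rewrite inE/= in_itv/= andbT => xt; case: ifPn => [|_]; last by rewrite mulr0.
  by rewrite inE/= in_itv/= andbT => t0; exfalso; apply: x0; lra.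
have cE x : e x * conv A B x = conv (fun x => e x * A x) (fun x => e x * B x) x.
  rewrite /conv -Rintegral_scale ?expR_gt0//; last first.
    apply: measurable_funM => //; apply: (measurableT_comp mA).
    exact: measurable_funB.
  apply: eq_Rintegral => t _.
  rewrite [RHS]mulrACA /e -expRD; congr (expR _ * _); ring.
apply/has_laplaceT; rewrite VE.
have -> : (fun x => e x * conv A B x) =
    conv (fun x => e x * A x) (fun x => e x * B x) by exact/funext.
have -> : (fun x => (e x * conv A B x)%:E) =
    EFin \o conv (fun x => e x * A x) (fun x => e x * B x).
  by apply/funext => x /=; rewrite cE.
split; first exact: integrable_conv.
have m1 : measurable_fun (setT : set R) (fun=> 1 : R) by exact: measurable_cst.
have := integral_conv_weight ia ib m1; under eq_integral do rewrite mul1r.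
move=> H; rewrite /Rintegral H => [|x]; last by rewrite normr1.
under eq_integral => s _.
  rewrite (_ : \int[leb]_t (1 * (e t * B t)) = Lb); first over.
  by rewrite -ibE; apply: eq_Rintegral => t _; rewrite mul1r.
under eq_integral do rewrite EFinM muleC.
rewrite integralZl// -[in RHS]iaE mulrC /Rintegral.
by rewrite -(fineK (integrable_fin_num _ ia)).
Qed.

End Volterra.

(** * The binomial series *)

Section BinomialSeries.
Variable R : realType.
Implicit Types (k c r x y : R) (u : R^nat).

Lemma natr_mul_norm (n : nat) (y : R) : n%:R * `|y| = `|n%:R * y|.
Proof. by rewrite normrM ger0_norm. Qed.

Lemma ratio_test u r N : 0 <= r < 1 ->
  (forall n, (N <= n)%N -> `|u n.+1| <= r * `|u n|) ->
  cvgn (series (fun n => `|u n|)).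
Proof.
move=> /andP[r0 r1] H.
have bnd j : `|u (j + N)%N| <= geometric `|u N| r j.
  elim: j => [|j IH]; first by rewrite /= expr0 mulr1.
  rewrite addSn; apply: le_trans (H _ (leq_addl _ _)) _.
  by rewrite /= exprS mulrCA ler_wpM2l.
have cg : cvgn (series (fun j => `|u (j + N)%N|)).
  apply: series_le_cvg bnd _ => //.
    by move=> n; rewrite /= mulr_ge0// exprn_ge0.
  by apply: is_cvg_geometric_series; rewrite ger0_norm.
rewrite -(is_cvg_series_restrict N).
move/cvg_ex : cg => [l cl]; apply/cvg_ex; exists l.
rewrite -(cvg_shiftn N); apply: cvg_trans cl; apply: near_eq_cvg.
apply: nearW => n.
by rewrite /series /= -{2}(add0n N) big_addn addnK.
Qed.

(** The terms of the binomial series and of its first two formal derivatives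
    satisfy such a growth condition, with [j] = 0, 1, 2. *)
Lemma linear_ratio_summable u k c j x : 0 < k -> k * `|x| < 1 ->
  (forall n, n.+1%:R * `|u n.+1| <= `|c + (n + j)%:R * k| * `|x| * `|u n|) ->
  cvgn (series (fun n => `|u n|)).
Proof.
move=> k0 kx H.
set A := (`|c| + j%:R * k) * `|x|.
have A0 : 0 <= A by rewrite mulr_ge0// addr_ge0// mulr_ge0// ltW.
pose r := (1 + k * `|x|) / 2.
have kx0 : 0 <= k * `|x| by rewrite mulr_ge0// ltW.
have rkx : 0 < r - k * `|x| by rewrite /r; lra.
pose N := Num.bound (A / (r - k * `|x|)).
apply: (@ratio_test u r N).
  by rewrite /r; apply/andP; split; lra.
move=> n Nn.
have Nr : A <= n%:R * (r - k * `|x|).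
  rewrite -ler_pdivrMr//; apply: ltW.
  have A1 : 0 <= A / (r - k * `|x|) by rewrite divr_ge0// ltW.
  by apply: lt_le_trans (archi_boundP A1) _; rewrite ler_nat.
rewrite -(ler_pM2l (ltr0Sn R n)); apply: le_trans (H n) _.
rewrite mulrA ler_wpM2r//.
apply: (@le_trans _ _ (A + n%:R * (k * `|x|))).
  rewrite /A (mulrA n%:R) -mulrDl ler_wpM2r//.
  apply: le_trans (ler_normD _ _) _; rewrite [X in _ + X]ger0_norm; last first.
    by rewrite mulr_ge0// ltW.
  by rewrite natrD; lra.
rewrite -natr1; have : 0 <= r by rewrite /r; lra.
lra.
Qed.

Definition kbinomial k c (n : nat) : R := kpochhammer k c n / n`!%:R.

Lemma kbinomialS k c n :
  n.+1%:R * kbinomial k c n.+1 = (c + n%:R * k) * kbinomial k c n.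
Proof.
rewrite /kbinomial /kpochhammer big_ord_recr/= factS natrM.
have h1 : n.+1%:R != 0 :> R by rewrite pnatr_eq0.
have h2 : n`!%:R != 0 :> R by rewrite pnatr_eq0 -lt0n fact_gt0.
by field; rewrite ?h1 ?h2 //= addrC natr1.
Qed.

Lemma kbinomial_summable k c x : 0 < k -> k * `|x| < 1 ->
  cvgn (series (fun n => `|kbinomial k c n * x ^+ n|)).
Proof.
move=> k0 kx; apply: (@linear_ratio_summable _ k c 0 x) => // n.
rewrite natr_mul_norm mulrA kbinomialS addn0.
by rewrite exprS !normrM; lra.
Qed.

Let diffs1 k c : pseries_diffs (kbinomial k c) =
  fun n => (c + n%:R * k) * kbinomial k c n.
Proof. by apply/funext => n; rewrite /pseries_diffs kbinomialS. Qed.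

Let diffs2 k c : pseries_diffs (pseries_diffs (kbinomial k c)) =
  fun n => (c + n.+1%:R * k) * ((c + n%:R * k) * kbinomial k c n).
Proof.
by apply/funext => n; rewrite /pseries_diffs kbinomialS mulrCA kbinomialS.
Qed.

Let sumf k c x := limn (pseries (kbinomial k c) x).

Let cvg0 k c x : 0 < k -> k * `|x| < 1 -> cvgn (pseries (kbinomial k c) x).
Proof.
by move=> k0 kx; apply: normed_cvg; exact: kbinomial_summable.
Qed.

Let cvg1 k c x : 0 < k -> k * `|x| < 1 ->
  cvgn (pseries (pseries_diffs (kbinomial k c)) x).
Proof.
move=> k0 kx; apply: normed_cvg.
apply: (@linear_ratio_summable _ k c 1 x) => // n.
rewrite diffs1 addn1 natr_mul_norm.
have -> : n.+1%:R * ((c + n.+1%:R * k) * kbinomial k c n.+1 * x ^+ n.+1) =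
    (c + n.+1%:R * k) * ((n.+1%:R * kbinomial k c n.+1) * x ^+ n.+1) by ring.
by rewrite /= kbinomialS exprS !normrM; lra.
Qed.

Let cvg2 k c x : 0 < k -> k * `|x| < 1 ->
  cvgn (pseries (pseries_diffs (pseries_diffs (kbinomial k c))) x).
Proof.
move=> k0 kx; apply: normed_cvg.
apply: (@linear_ratio_summable _ k c 2 x) => // n.
rewrite diffs2 addn2 natr_mul_norm.
have -> : n.+1%:R * ((c + n.+2%:R * k) * ((c + n.+1%:R * k) * kbinomial k c n.+1) *
      x ^+ n.+1) = (c + n.+2%:R * k) * (c + n.+1%:R * k) *
    ((n.+1%:R * kbinomial k c n.+1) * x ^+ n.+1) by ring.
by rewrite /= kbinomialS exprS !normrM; lra.
Qed.

Let dsum k c x : 0 < k -> k * `|x| < 1 ->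
  is_derive x 1 (sumf k c) (limn (pseries (pseries_diffs (kbinomial k c)) x)).
Proof.
move=> k0 kx; pose K := (`|x| + k^-1) / 2.
have xk : `|x| < k^-1 by rewrite -(ltr_pM2l k0) divff// gt_eqF.
have K0 : 0 < K by have := normr_ge0 x; rewrite /K; lra.
have kK : k * `|K| < 1.
  by rewrite gtr0_norm// -[1](divff (lt0r_neq0 k0)) ltr_pM2l// /K; lra.
apply: (@pseries_snd_diffs _ _ K); [exact: cvg0|exact: cvg1|exact: cvg2|].
by rewrite [`|K|]gtr0_norm// /K; lra.
Qed.

Let ode k c x : 0 < k -> k * `|x| < 1 ->
  (1 - k * x) * limn (pseries (pseries_diffs (kbinomial k c)) x) = c * sumf k c x.
Proof.
move=> k0 kx.
set D := limn _.
have h := pseries_diffs_equiv (@cvg1 k c x k0 kx); rewrite -/D in h.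
suff E : D = c * sumf k c x + k * x * D by rewrite mulrBl mul1r {1}E addrK.
apply/cvg_lim => //.
have : c * pseries (kbinomial k c) x n + k * x *
   (series (fun n => n%:R * kbinomial k c n * x ^+ n.-1) n) @[n --> \oo] -->
   c * sumf k c x + k * x * D.
  apply: cvgD; apply: cvgM => //; try exact: cvg_cst.
  exact: cvg0.
apply: cvg_trans; apply: near_eq_cvg; near=> n.
rewrite /pseries /series /= !mulr_sumr -big_split/=; apply: eq_bigr => i _.
rewrite diffs1; case: i => [|i]; first by rewrite /=; ring.
by rewrite /= exprS; ring.
Unshelve. all: by end_near. Qed.

(** The sum B satisfies (1 - kx) B' = c B, so the derivative of
    B(x) (1 - kx)^(c/k) vanishes. *)
Theorem kbinomial_series k c x : 0 < k -> k * `|x| < 1 ->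
  limn (pseries (kbinomial k c) x) = (1 - k * x) `^ (- (c / k)).
Proof.
move=> k0 kx.
have pos y : k * `|y| < 1 -> 0 < 1 - k * y.
  move=> ky; have : k * y <= k * `|y| by rewrite ler_pM2l// ler_norm.
  lra.
pose g y := sumf k c y * (1 - k * y) `^ (c / k).
have dg y : k * `|y| < 1 -> is_derive y 1 g 0.
  move=> ky; have ky1 := pos y ky.
  have d1 := @dsum k c y k0 ky.
  have d2 : is_derive y 1 (fun z : R => 1 - k * z) (- k).
    by apply: is_derive_eq; rewrite /GRing.scale/=; ring.
  have d3 := is_derive1_powR (c / k) ky1.
  have d4 := @is_derive1_comp R (fun z => z `^ (c / k)) (fun z => 1 - k * z) y _ _ d3 d2.
  have d5 := is_deriveM d1 d4.
  apply: is_derive_eq d5 _; rewrite /GRing.scale /=.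
  have o := @ode k c y k0 ky.
  have -> : (1 - k * y) `^ (c / k) = (1 - k * y) * (1 - k * y) `^ (c / k - 1).
    rewrite -{2}(powRr1 (ltW ky1)) -powRD ?(gt_eqF ky1) ?implybT//.
    by congr (_ `^ _); ring.
  have -> : c / k * (1 - k * y) `^ (c / k - 1) * - k =
      - (c * (1 - k * y) `^ (c / k - 1)) by field; rewrite gt_eqF.
  rewrite mulrAC o; ring.
have cst y : k * `|y| < 1 -> g y = g 0.
  move=> ky; have ky0 : k * `|0 : R| < 1 by rewrite normr0 mulr0.
  have cont a b : (forall z, a <= z <= b -> k * `|z| < 1) ->
      {within `[a, b], continuous g}.
    move=> H; apply: continuous_in_subspaceT => z; rewrite inE/= in_itv/= => zab.
    have [+ _] := dg z (H z zab).
    by move=> /derivable1_diffP/differentiable_continuous.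
  have [y0|y0] := leP 0 y.
    have [|||z zab] := @MVT_segment R g (fun=> 0) 0 y.
    - exact: y0.
    - move=> z; rewrite in_itv/= => /andP[z0 zy]; apply: dg.
      by apply: le_lt_trans ky; rewrite ler_pM2l// !ger0_norm// ltW.
    - apply: cont => z /andP[z0 zy].
      by apply: le_lt_trans ky; rewrite ler_pM2l// !ger0_norm.
    - by rewrite mul0r => /eqP; rewrite subr_eq0 => /eqP.
  have [|||z zab] := @MVT_segment R g (fun=> 0) y 0.
  - exact: ltW.
  - move=> z; rewrite in_itv/= => /andP[z0 zy]; apply: dg.
    apply: le_lt_trans ky; rewrite ler_pM2l// !ler0_norm ?lerN2//; exact: ltW.
  - apply: cont => z /andP[z0 zy].
    by apply: le_lt_trans ky; rewrite ler_pM2l// !ler0_norm ?lerN2// ltW.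
  - by rewrite mul0r => /eqP; rewrite subr_eq0 => /eqP.
have g0 : g 0 = 1.
  rewrite /g mulr0 subr0 powR1 mulr1; apply/cvg_lim => //.
  rewrite -(cvg_shiftS _); apply: cvg_near_cst; apply: nearW => n.
  rewrite /pseries /series /= big_nat_recl//= big1 ?addr0.
    by rewrite expr0 mulr1 /kbinomial /kpochhammer big_ord0 fact0 divr1.
  by move=> i _; rewrite exprS mul0r mulr0.
have kx1 := pos x kx.
have := cst x kx; rewrite g0 /g -/(sumf k c x) powRN => h.
have nz : (1 - k * x) `^ (c / k) != 0 by rewrite gt_eqF// powR_gt0.
by apply: (mulIf nz); rewrite mulVf.
Qed.

End BinomialSeries.

(** * Change of variables on the half-line *)

Section HalfLine.
Variable R : realType.
Local Notation leb := (@lebesgue_measure R).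
Implicit Types (F G : R -> R) (n : nat).

Definition exhaust n : interval R := `[n.+1%:R^-1, n.+1%:R].

Lemma exhaustP x : 0 < x -> exists n, x \in exhaust n.
Proof.
move=> x0; pose n := maxn (Num.bound x) (Num.bound x^-1).
exists n; rewrite in_itv/=; apply/andP; split.
  rewrite -[leRHS]invrK lef_pV2 ?posrE ?invr_gt0//.
  apply: le_trans (ltW (archi_boundP _)) _; first by rewrite ltW ?invr_gt0.
  by rewrite ler_nat leqW// leq_maxr.
apply: le_trans (ltW (archi_boundP (ltW x0))) _.
by rewrite ler_nat leqW// leq_maxl.
Qed.

Lemma exhaust_gt0 n x : x \in exhaust n -> 0 < x.
Proof. by rewrite in_itv/= => /andP[+ _]; apply: lt_le_trans. Qed.

Lemma exhaust_bounds n m : (n <= m)%N ->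
  (m.+1%:R^-1 <= n.+1%:R^-1 :> R) && (n.+1%:R <= m.+1%:R :> R).
Proof. by move=> nm; rewrite lef_pV2 ?posrE// !ler_nat ltnS nm. Qed.

Lemma exhaust_bigcup : \bigcup_n [set` exhaust n] = `]0, +oo[%classic :> set R.
Proof.
apply/seteqP; split => [x [n _ /= /exhaust_gt0]|x] /=; rewrite in_itv/= andbT//.
by move=> /exhaustP[n xn]; exists n.
Qed.

Lemma measurable_halfline (f : R -> R) :
  (forall x : R, 0 < x -> {for x, continuous f}) -> measurable_fun (`]0, +oo[%classic : set R) f.
Proof.
move=> cf; apply: open_continuous_measurable_fun; first exact: interval_open.
by move=> x; rewrite inE/= in_itv/= andbT => /cf.
Qed.

Lemma sub_halfline (D : set R) : (forall x, D x -> 0 < x) -> D `<=` `]0, +oo[%classic.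
Proof. by move=> D0 x /D0; rewrite /= in_itv/= andbT. Qed.

Lemma ge0_integral_exhaust (f : R -> R) :
  (forall x : R, 0 < x -> {for x, continuous f}) -> (forall x : R, 0 < x -> 0 <= f x) ->
  (\int[leb]_(x in [set` exhaust n]) (f x)%:E @[n --> \oo] -->
   \int[leb]_(x in `]0%R, +oo[) (f x)%:E)%E.
Proof.
move=> cf f0; rewrite -exhaust_bigcup.
apply: ge0_nondecreasing_set_cvg_integral => //.
- move=> n m /exhaust_bounds/andP[h1 h2]; apply/subsetPset.
  by apply: subset_itv; rewrite bnd_simp.
- move=> n; apply: (@measurable_funS _ _ _ _ (`]0%R, +oo[%classic : set R)) => //.
    by apply: sub_halfline => x /exhaust_gt0.
  by apply/measurable_EFinP; exact: measurable_halfline.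
- by move=> n x /exhaust_gt0 /f0; rewrite lee_fin.
Qed.

(** [F'] and [G] may be unbounded near 0 and at infinity, so the substitution is
    made on compact intervals, over which one passes to the limit. *)
Lemma ge0_integration_by_substitution_halfline F (F' : R -> R) G :
  (forall x : R, 0 < x -> 0 < F x) ->
  (forall x y : R, 0 < x -> x < y -> F x < F y) ->
  (forall y : R, 0 < y -> exists2 x : R, 0 < x & F x = y) ->
  (forall x : R, 0 < x -> is_derive x 1 F (F' x)) ->
  (forall x : R, 0 < x -> 0 <= F' x) ->
  (forall x : R, 0 < x -> {for x, continuous F'}) ->
  (forall x : R, 0 < x -> {for x, continuous G}) ->
  (forall x : R, 0 < x -> 0 <= G x) ->
  (\int[leb]_(x in `]0%R, +oo[) (G x)%:E =
   \int[leb]_(x in `]0%R, +oo[) (G (F x) * F' x)%:E)%E.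
Proof.
move=> F0 Fincr Fsurj dF F'0 cF' cG G0.
have cF (x : R) : 0 < x -> {for x, continuous F}.
  by move=> /dF[/derivable1_diffP/differentiable_continuous].
have Fle (x y : R) : 0 < x -> x <= y -> F x <= F y.
  by move=> x0; rewrite le_eqVlt => /predU1P[->//|/(Fincr _ _ x0)/ltW].
pose B n : interval R := `[F n.+1%:R^-1, F n.+1%:R].
have E n : (\int[leb]_(x in [set` B n]) (G x)%:E =
    \int[leb]_(x in [set` exhaust n]) (G (F x) * F' x)%:E)%E.
  have n0 : 0 < n.+1%:R^-1 :> R by [].
  have n1 : 0 < n.+1%:R :> R by [].
  have F'E (x : R) : 0 < x -> {near x, derive1 F =1 F'}.
    move=> x0; near=> z; have z0 : 0 < z by near: z; exact: lt_nbhsr.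
    by rewrite derive1E; by have [_ ->] := dF _ z0.
  have cdF (x : R) : 0 < x -> {for x, continuous (derive1 F)}.
    move=> x0; have E0 : derive1 F x = F' x by exact: (nbhs_singleton (F'E x x0)).
    have cx : F' z @[z --> x] --> F' x by exact: cF'.
    suff : derive1 F z @[z --> x] --> derive1 F x by [].
    rewrite E0; apply: cvg_trans cx; apply: near_eq_cvg; near=> z.
    by apply/esym; near: z; exact: F'E.
  rewrite integration_by_substitution_increasing.
  - by apply: eq_integral => x; rewrite inE/= => /exhaust_gt0 x0;
      rewrite /= fctE (nbhs_singleton (F'E x x0)).
  - by rewrite (le_trans (y := 1))// ?invf_le1 ?ler1n.
  - by move=> x y /exhaust_gt0 x0 _; exact: Fincr.
  - move=> x; rewrite in_itv/= => /andP[h _]; apply: cdF; exact: lt_trans h.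
  - apply/cvg_ex; exists (derive1 F n.+1%:R^-1); apply: cvg_at_right_filter; exact: cdF.
  - apply/cvg_ex; exists (derive1 F n.+1%:R); apply: cvg_at_left_filter; exact: cdF.
  - split.
    + by move=> x; rewrite in_itv/= => /andP[h _]; have [] := dF x (lt_trans n0 h).
    + by apply: cvg_at_right_filter; exact: cF.
    + by apply: cvg_at_left_filter; exact: cF.
  - apply: continuous_in_subspaceT => x; rewrite inE/= in_itv/= => /andP[h _].
    by apply: cG; apply: lt_le_trans h; exact: F0.
have cGF (x : R) : 0 < x -> {for x, continuous (fun x => G (F x) * F' x)}.
  move=> x0; apply: cvgM; last exact: cF'.
  apply: continuous_comp; first exact: cF.
  by apply: cG; exact: F0.
have GF0 (x : R) : 0 < x -> 0 <= G (F x) * F' x.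
  by move=> x0; rewrite mulr_ge0 ?F'0 ?G0 ?F0.
have cvgR := ge0_integral_exhaust cGF GF0.
have cup : \bigcup_n [set` B n] = `]0, +oo[%classic :> set R.
  apply/seteqP; split => [x [n _]|x] /=; rewrite !in_itv/= andbT.
    by move=> /andP[+ _]; apply: lt_le_trans; exact: F0.
  move=> /Fsurj[z z0 <-]; have [n] := exhaustP z0; rewrite in_itv/= => /andP[h1 h2].
  by exists n => //=; rewrite in_itv/= !Fle.
have cvgL : (\int[leb]_(x in [set` B n]) (G x)%:E @[n --> \oo] -->
   \int[leb]_(x in `]0%R, +oo[) (G x)%:E)%E.
  rewrite -cup.
  have pos n x : x \in B n -> 0 < x.
    by rewrite in_itv/= => /andP[+ _]; apply: lt_le_trans; exact: F0.
  apply: ge0_nondecreasing_set_cvg_integral => //.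
  - move=> n m /exhaust_bounds/andP[h1 h2]; apply/subsetPset.
    by apply: subset_itv; rewrite bnd_simp Fle.
  - move=> n; apply: (@measurable_funS _ _ _ _ (`]0%R, +oo[%classic : set R)) => //.
      by apply: sub_halfline => x /pos.
    by apply/measurable_EFinP; exact: measurable_halfline.
  - by move=> n x /pos /G0; rewrite lee_fin.
have EE : (fun n => \int[leb]_(x in [set` B n]) (G x)%:E)%E =
    (fun n => \int[leb]_(x in [set` exhaust n]) (G (F x) * F' x)%:E)%E.
  by apply/funext => n; exact: E.
rewrite EE in cvgL; exact: (cvg_unique _ cvgL cvgR).
Unshelve. all: by end_near. Qed.

End HalfLine.

(** * The k-gamma function *)

Section KGamma.
Variable R : realType.
Local Notation leb := (@lebesgue_measure R).
Implicit Types (k p a z s M x t : R).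

Lemma continuous_powRl a x : 0 < x -> {for x, continuous (fun y => y `^ a)}.
Proof.
move=> x0; have [+ _] := is_derive1_powR a x0.
by move=> /derivable1_diffP/differentiable_continuous.
Qed.

Lemma continuous_expRNM p x : {for x, continuous (fun y => expR (- (p * y)))}.
Proof.
apply: continuous_comp; last exact: continuous_expR.
by apply: cvgN; apply: cvgM; [exact: cvg_cst|exact: cvg_id].
Qed.

Let gam k z t := expR (- (t `^ k) / k) * t `^ (z - 1).
Let lap p a x := expR (- (p * x)) * x `^ (a - 1).

Let lap0 p a x : 0 <= lap p a x.
Proof. by rewrite mulr_ge0 ?expR_ge0 ?powR_ge0. Qed.

Let gam0 k z x : 0 <= gam k z x.
Proof. by rewrite mulr_ge0 ?expR_ge0 ?powR_ge0. Qed.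

Let clap p a x : 0 < x -> {for x, continuous (lap p a)}.
Proof.
by move=> x0; apply: cvgM; [exact: continuous_expRNM|exact: continuous_powRl].
Qed.

Let cgam k z x : 0 < x -> {for x, continuous (gam k z)}.
Proof.
move=> x0; apply: cvgM; last exact: continuous_powRl.
apply: continuous_comp; last exact: continuous_expR.
by apply: cvgM; [apply: cvgN; exact: continuous_powRl|exact: cvg_cst].
Qed.

(** The substitution x = t^k / (k p). *)
Lemma integral_laplace_power k p z : 0 < k -> 0 < p ->
  (\int[leb]_(x in `]0%R, +oo[) (expR (- (p * x)) * x `^ (z / k - 1))%:E =
   (k * (k * p) `^ (- (z / k)))%:E *
   \int[leb]_(t in `]0%R, +oo[) (expR (- (t `^ k) / k) * t `^ (z - 1))%:E)%E.
Proof.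
move=> k0 p0; have kp0 : 0 < k * p by rewrite mulr_gt0.
transitivity (\int[leb]_(t in `]0%R, +oo[)
  (lap p (z / k) (t `^ k / (k * p)) * (t `^ (k - 1) / p))%:E)%E.
  apply: (@ge0_integration_by_substitution_halfline R
    (fun t => t `^ k / (k * p)) (fun t => t `^ (k - 1) / p) (lap p (z / k))).
  - by move=> x x0; rewrite divr_gt0// powR_gt0.
  - move=> x y x0 xy; rewrite ltr_pM2r ?invr_gt0//.
    by apply: gt0_ltr_powR => //; rewrite nnegrE ltW//; exact: lt_trans xy.
  - move=> y y0; exists ((y * (k * p)) `^ (k^-1)); first by rewrite powR_gt0// mulr_gt0.
    rewrite -powRrM mulVf ?gt_eqF// powRr1 ?mulfK ?gt_eqF//.
    by rewrite ltW// mulr_gt0.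
  - move=> x x0; have d := is_derive1_powR k x0.
    have -> : (fun t => t `^ k / (k * p)) = (k * p)^-1 *: (fun t => t `^ k).
      by apply/funext => t; rewrite mulrC.
    apply: is_derive_eq; rewrite /GRing.scale/=; field; rewrite !gt_eqF//.
  - by move=> x x0; rewrite divr_ge0 ?powR_ge0 ?ltW.
  - by move=> x x0; apply: cvgM; [exact: continuous_powRl|exact: cvg_cst].
  - by move=> x; exact: clap.
  - by move=> x _; exact: lap0.
rewrite -ge0_integralZl_EFin//; last 3 first.
+ by move=> t _; rewrite lee_fin; exact: gam0.
+ by apply/measurable_EFinP; apply: measurable_halfline => x; exact: cgam.
+ by rewrite mulr_ge0 ?powR_ge0 ?ltW.
apply: eq_integral => t; rewrite inE/= in_itv/= andbT => t0.
rewrite -EFinM; congr (_%:E); rewrite /lap.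
have -> : p * (t `^ k / (k * p)) = t `^ k / k by field; rewrite !gt_eqF.
rewrite -mulNr -mulrA; rewrite [in RHS]mulrCA; congr (_ * _).
rewrite powRM ?powR_ge0 ?invr_ge0 ?ltW// -(powR_inv1 (ltW kp0)) -!powRrM.
have -> : k * (z / k - 1) = (z - 1) - (k - 1) by field; rewrite gt_eqF.
have -> : -1 * (z / k - 1) = 1 + - (z / k) by ring.
rewrite (@powRB _ t (z - 1)) ?(lt0r_neq0 t0) ?implybT//.
rewrite (@powRD _ (k * p) 1) ?(lt0r_neq0 kp0) ?implybT// powRr1 ?(ltW kp0)//.
have h : t `^ (k - 1) != 0 by rewrite gt_eqF// powR_gt0.
by field; rewrite h gt_eqF.
Qed.

Let powR_le_exp p a : 0 < p -> 0 < a -> exists2 C : R, 0 < C &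
  forall x, 0 < x -> x `^ a <= C * expR (p * x).
Proof.
move=> p0 a0; pose d := p / a; have d0 : 0 < d by rewrite divr_gt0.
exists (expR (- (a * ln d))); first exact: expR_gt0.
move=> x x0; rewrite -expRD /powR gt_eqF// ler_expR.
have := ltW (ln_sublinear (mulr_gt0 d0 x0)).
rewrite lnM ?posrE// => h.
have : a * (ln d + ln x) <= a * (d * x) by rewrite ler_pM2l.
have -> : a * (d * x) = p * x by rewrite /d; field; rewrite gt_eqF.
lra.
Qed.

(** Up to a constant, the integrand is below the derivative of
    -1 / (1 + x^a), a bounded function. *)
Lemma integral_laplace_power_lty p a : 0 < p -> 0 < a ->
  (\int[leb]_(x in `]0%R, +oo[) (expR (- (p * x)) * x `^ (a - 1))%:E < +oo)%E.
Proof.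
move=> p0 a0.
(* C absorbs the factor (1 + x^a)^2 of the derivative into exp(px). *)
have [C C0 HC] := @powR_le_exp (p / 2) a ltac:(by rewrite divr_gt0) a0.
pose h x : R := - (1 + x `^ a)^-1.
pose dh x : R := (a * x `^ (a - 1)) / (1 + x `^ a) ^+ 2.
have den x : 0 < 1 + x `^ a by rewrite ltr_pwDl// powR_ge0.
have hd x : 0 < x -> is_derive x 1 h (dh x).
  move=> x0; have d := is_derive1_powR a x0.
  have d1 : is_derive x 1 (fun y : R => 1 + y `^ a) (a * x `^ (a - 1)).
    by apply: is_derive_eq; rewrite add0r mul1r.
  have := is_deriveN (@is_deriveV R (fun y => 1 + y `^ a) x _ _ (lt0r_neq0 (den x)) d1).
  move/is_derive_eq; apply; rewrite /dh /GRing.scale/= mulNr opprK mulrC.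
  by rewrite -exprVn.
have cdh x : 0 < x -> {for x, continuous dh}.
  move=> x0; apply: cvgM.
    by apply: cvgM; [exact: cvg_cst|exact: continuous_powRl].
  apply: cvgV; first by rewrite expf_neq0// gt_eqF.
  by apply: cvgM; (apply: cvgD; [exact: cvg_cst|exact: continuous_powRl]).
pose D := (1 + C) ^+ 2 / a.
have D0 : 0 < D by rewrite divr_gt0// exprn_gt0// addr_gt0.
have bnd x : 0 < x -> lap p a x <= D * dh x.
  move=> x0; rewrite /D /dh.
  have -> : (1 + C) ^+ 2 / a * (a * x `^ (a - 1) / (1 + x `^ a) ^+ 2) =
      ((1 + C) / (1 + x `^ a)) ^+ 2 * x `^ (a - 1).
    by field; rewrite !gt_eqF.
  rewrite ler_wpM2r ?powR_ge0//.
  have -> : - (p * x) = - (p / 2 * x) + - (p / 2 * x) by lra.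
  rewrite expRD -expr2 ler_pXn2r ?nnegrE ?expR_ge0//; last first.
    by apply: divr_ge0; [lra|exact: ltW].
  rewrite ler_pdivlMr// expRN mulrC ler_pdivrMr ?expR_gt0//.
  rewrite mulrDl mul1r lerD ?HC//.
  have px : 0 < p / 2 * x by rewrite mulr_gt0// divr_gt0.
  by apply: le_trans (expR_ge1Dx _); lra.
apply: (@le_lt_trans _ _ D%:E); last exact: ltry.
have cv := @ge0_integral_exhaust R (lap p a) (@clap p a) (fun x _ => lap0 p a x).
rewrite -(cvg_lim _ cv)//; apply: lime_le; first by apply/cvg_ex; eexists; exact: cv.
apply: nearW => n.
have n0 : 0 < n.+1%:R^-1 :> R by [].
apply: (@le_trans _ _ (\int[leb]_(x in [set` exhaust R n]) (D * dh x)%:E)%E).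
  apply: ge0_le_integral => //.
  - by move=> x _; rewrite lee_fin; exact: lap0.
  - apply: (@measurable_funS _ _ _ _ (`]0%R, +oo[%classic : set R)) => //.
      by apply: sub_halfline => x /exhaust_gt0.
    by apply/measurable_EFinP; apply: measurable_halfline => x; exact: clap.
  - apply: (@measurable_funS _ _ _ _ (`]0%R, +oo[%classic : set R)) => //.
      by apply: sub_halfline => x /exhaust_gt0.
    apply/measurable_EFinP; apply: measurable_halfline => x x0.
    by apply: cvgM; [exact: cvg_cst|exact: cdh].
  - by move=> x /exhaust_gt0 /bnd; rewrite lee_fin.
have [->|n1] := eqVneq n 0%N.
  rewrite /exhaust invr1 set_itv1 integral_set1 lee_fin; exact: ltW.
have lt1 : n.+1%:R^-1 < n.+1%:R :> R.
  by rewrite (lt_le_trans (y := 1)) ?ler1n// invf_lt1// ltr1n ltnS lt0n.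
under eq_integral do rewrite EFinM.
rewrite ge0_integralZl_EFin//; last 3 first.
- move=> x _; rewrite lee_fin divr_ge0 ?mulr_ge0 ?powR_ge0 ?sqr_ge0//; exact: ltW.
- apply: (@measurable_funS _ _ _ _ (`]0%R, +oo[%classic : set R)) => //.
    by apply: sub_halfline => x /exhaust_gt0.
  by apply/measurable_EFinP; apply: measurable_halfline => x; exact: cdh.
- exact: ltW.
rewrite (@continuous_FTC2 R dh h)//.
- rewrite -EFinB -EFinM lee_fin -[leRHS]mulr1 ler_pM2l// /h.
  have h1 : 0 <= (1 + n.+1%:R `^ a)^-1 by rewrite invr_ge0 ltW.
  have h2 : (1 + n.+1%:R^-1 `^ a)^-1 <= 1 by rewrite invf_le1// lerDl powR_ge0.
  lra.
- apply: continuous_in_subspaceT => x; rewrite inE/= => /exhaust_gt0; exact: cdh.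
- have ch x : 0 < x -> {for x, continuous h}.
    by move=> /hd[/derivable1_diffP/differentiable_continuous].
  split.
  + by move=> x; rewrite in_itv/= => /andP[xn _]; have [] := hd x (lt_trans n0 xn).
  + by apply: cvg_at_right_filter; exact: ch.
  + by apply: cvg_at_left_filter; exact: ch.
- move=> x; rewrite in_itv/= => /andP[xn _].
  by have [_ <-] := hd x (lt_trans n0 xn); rewrite derive1E.
Qed.

Lemma integral_kGamma k z : 0 < k -> 0 < z ->
  (\int[leb]_(t in `]0%R, +oo[) (expR (- (t `^ k) / k) * t `^ (z - 1))%:E =
   (kGamma k z)%:E)%E.
Proof.
move=> k0 z0; rewrite /kGamma /Rintegral fineK// ge0_fin_numE; last first.
  by apply: integral_ge0 => t _; rewrite lee_fin; exact: gam0.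
have := @integral_laplace_power_lty 1 (z / k) ltr01 ltac:(by rewrite divr_gt0).
rewrite integral_laplace_power//.
have c0 : 0 < k * (k * 1) `^ (- (z / k)) by rewrite mulr1 mulr_gt0// powR_gt0.
case: (integral _ _ _) => [r _||//]; first exact: ltry.
by rewrite gt0_muley.
Qed.

Lemma integral_laplace_power_kGamma k p z : 0 < k -> 0 < p -> 0 < z ->
  (\int[leb]_(x in `]0%R, +oo[) (expR (- (p * x)) * x `^ (z / k - 1))%:E =
   (k * (k * p) `^ (- (z / k)) * kGamma k z)%:E)%E.
Proof. by move=> k0 p0 z0; rewrite integral_laplace_power// integral_kGamma. Qed.

(** Only the part of the integral over [[M, M + 1]] is kept. The bound grows
    geometrically in [s] with the arbitrary ratio [M]. *)
Lemma kGamma_lower_bound k z s M : 0 < k -> 0 < z -> 0 <= s -> 1 <= M ->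
  M `^ s * (expR (- ((M + 1) `^ k) / k) / (M + 1)) <= kGamma k (z + s).
Proof.
move=> k0 z0 s0 M1; have M0 : 0 < M by exact: lt_le_trans M1.
rewrite -lee_fin -integral_kGamma ?ltr_wpDr//.
set c := (X in (X%:E <= _)%E).
have -> : (c%:E = \int[leb]_(x in `[M, (M + 1)%R]) (cst c%:E) x)%E.
  rewrite integral_cst//.
  rewrite -[LHS]mule1; congr (_ * _)%E; apply/esym.
  transitivity (leb `[M, M + 1]%classic) => //.
  by rewrite lebesgue_measure_itv/= lte_fin ltrDl ltr01 -EFinB addrAC subrr add0r.
have sub : `[M, M + 1] `<=` (`]0%R, +oo[%classic : set R).
  by apply: sub_halfline => x; rewrite /= in_itv/= => /andP[+ _]; exact: lt_le_trans.
have mg : measurable_fun (`]0%R, +oo[%classic : set R)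
    (fun t => (expR (- (t `^ k) / k) * t `^ (z + s - 1))%:E).
  by apply/measurable_EFinP; apply: measurable_halfline => x; exact: cgam.
apply: (@le_trans _ _ (\int[leb]_(t in `[M, (M + 1)%R])
    (expR (- (t `^ k) / k) * t `^ (z + s - 1))%:E)%E); last first.
  apply: ge0_subset_integral => //.
  by move=> t _; rewrite lee_fin; exact: gam0.
apply: ge0_le_integral => //.
- move=> x _; rewrite lee_fin /c mulr_ge0 ?powR_ge0// divr_ge0 ?expR_ge0//; lra.
- exact: (measurable_funS _ sub mg).
move=> x; rewrite /= in_itv/= => /andP[Mx xM]; rewrite lee_fin /c.
have x0 : 0 < x by exact: lt_le_trans Mx.
rewrite mulrCA; apply: ler_pM.
- exact: expR_ge0.
- by rewrite divr_ge0 ?powR_ge0//; lra.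
- rewrite ler_expR !mulNr lerN2 ler_pM2r ?invr_gt0//.
  by apply: ge0_ler_powR; rewrite ?nnegrE; lra.
- rewrite powRB ?(lt0r_neq0 x0) ?implybT// powRr1 ?(ltW x0)//.
  apply: ler_pM; rewrite ?powR_ge0// ?invr_ge0; first lra.
    have -> : x `^ (z + s) = x `^ s * x `^ z.
      by rewrite addrC powRD// (lt0r_neq0 x0) implybT.
    rewrite -[leLHS]mulr1; apply: ler_pM; rewrite ?powR_ge0//.
      by apply: ge0_ler_powR; rewrite ?nnegrE; lra.
    by rewrite -(powRr0 x); apply: ler_powR; [lra|exact: ltW].
  rewrite lef_pV2 ?posrE//; lra.
Qed.

Lemma kGamma_gt0 k z : 0 < k -> 0 < z -> 0 < kGamma k z.
Proof.
move=> k0 z0; have := @kGamma_lower_bound k z 0 1 k0 z0 (lexx _) (lexx _).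
rewrite addr0; apply: lt_le_trans.
by rewrite powRr0 mul1r divr_gt0 ?expR_gt0.
Qed.

End KGamma.

(** * Termwise integration of a series *)

Section IntegralSeries.
Variable R : realType.
Local Notation leb := (@lebesgue_measure R).

(** Dominated convergence of the partial sums, below the sum of the absolute
    values. *)
Lemma integral_series (D : set (measurableTypeR R)) (T : nat -> R -> R) (u : R^nat) (f : R -> R) :
  measurable D -> (forall n, leb.-integrable D (EFin \o T n)) ->
  (forall n, \int[leb]_(x in D) `|T n x|%:E = (u n)%:E)%E -> cvgn (series u) ->
  (forall x, D x -> series (T ^~ x) n @[n --> \oo] --> f x) ->
  leb.-integrable D (EFin \o f) /\
  series (fun n => \int[leb]_(x in D) T n x) n @[n --> \oo] -->
    \int[leb]_(x in D) f x.
Proof.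
move=> mD iT uE cu cf.
have mT n : measurable_fun D (T n) by have /integrableP[/measurable_EFinP] := iT n.
pose g x := (\sum_(0 <= n <oo) `|T n x|%:E)%E.
have mabs n : measurable_fun D (fun x => `|T n x|%:E).
  by apply/measurable_EFinP; exact: measurableT_comp.
have g0 x : (0 <= g x)%E by apply: nneseries_ge0 => n _ _; rewrite lee_fin.
have ig : leb.-integrable D g.
  apply/integrableP; split.
    by apply: ge0_emeasurable_sum => [n x _ _|n _]; [rewrite lee_fin|exact: mabs].
  under eq_integral do rewrite gee0_abs//.
  rewrite /g integral_nneseries//.
  rewrite (_ : (fun n => _) = EFin \o series u); last first.
    by apply/funext => n /=; under eq_bigr do rewrite uE; rewrite sumEFin.
  by rewrite EFin_lim// ltry.
pose F n x := (series (T ^~ x) n)%:E.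
have FE n x : F n x = (\sum_(0 <= i < n) (T i x)%:E)%E by rewrite sumEFin.
have mF n : measurable_fun D (F n).
  by apply/measurable_EFinP; apply: measurable_sum.
have mf : measurable_fun D (EFin \o f).
  apply/measurable_EFinP; apply: (measurable_fun_cvg (h := fun n x => series (T ^~ x) n)) => //.
  by move=> n; apply: measurable_sum.
have cF x : D x -> F n x @[n --> \oo] --> (EFin \o f) x.
  by move=> Dx; apply: cvg_EFin; [exact: nearW|exact: cf].
have bF : {ae leb, forall x n, D x -> (`|F n x| <= g x)%E}.
  apply: aeW => x n Dx; apply: (@le_trans _ _ (\sum_(0 <= i < n) `|T i x|%:E)%E).
    by rewrite sumEFin /= lee_fin; exact: ler_norm_sum.
  by apply: nneseries_lim_ge => i _ _; rewrite lee_fin.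
have [fi _ cv] := @dominated_convergence _ _ _ leb D mD F (EFin \o f) g mF mf (aeW leb cF) ig bF.
split => //.
have fin : (\int[leb]_(x in D) (f x)%:E)%E \is a fin_num by exact: integrable_fin_num.
have {cv} := cv; rewrite -[X in _ --> X](fineK fin) => /fine_cvgP[_].
apply: cvg_trans; apply: near_eq_cvg; apply: nearW => n /=.
under eq_integral do rewrite FE.
rewrite integral_sum// /series /=.
under eq_bigr do rewrite -(fineK (integrable_fin_num mD (iT _))).
by rewrite sumEFin.
Qed.

End IntegralSeries.

(** * The Mittag-Leffler kernel *)

Section MittagLefflerKernel.
Variable R : realType.
Local Notation leb := (@lebesgue_measure R).
Variables (k alpha m c : R).
Hypotheses (k0 : 0 < k) (alpha0 : 0 < alpha) (m0 : 0 < m).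

Let G n := kGamma k (alpha * n%:R + m).

Let arg_gt0 n : 0 < alpha * n%:R + m.
Proof. by rewrite ltr_wpDl// mulr_ge0// ltW. Qed.

Let G0 n : 0 < G n.
Proof. exact: kGamma_gt0. Qed.

Let term z n : R :=
  kpochhammer k c n / kGamma k (alpha * n%:R + m) * (z ^+ n / n`!%:R).

Let termE z n : term z n = kbinomial k c n * z ^+ n / G n.
Proof. by rewrite /term /kbinomial -/(G n); ring. Qed.

(** The k-gamma function outgrows every geometric sequence: the terms are
    dominated by those of a convergent binomial series. *)
Lemma kMittagLeffler_cvg z : cvgn (series (term z)).
Proof.
apply: normed_cvg.
(* M is chosen with M^alpha > k |z|, the radius needed for the binomial series. *)
pose y := 2 * (k * `|z|) + 1.
pose M := Num.max 1 (y `^ alpha^-1).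
have kz : 0 <= k * `|z| by rewrite mulr_ge0// ltW.
have y0 : 0 < y by rewrite /y; lra.
have M1 : 1 <= M by rewrite le_max lexx.
have M0 : 0 < M by lra.
have yM : y <= M `^ alpha.
  have -> : y = (y `^ alpha^-1) `^ alpha.
    by rewrite -powRrM mulVf ?gt_eqF// powRr1// ltW.
  apply: ge0_ler_powR; rewrite ?nnegrE ?powR_ge0//; [exact: ltW|exact: ltW|].
  by rewrite le_max lexx orbT.
have Ma0 : 0 < M `^ alpha by exact: powR_gt0.
pose x := `|z| / M `^ alpha.
have kx : k * `|x| < 1.
  rewrite /x ger0_norm ?divr_ge0 ?powR_ge0// mulrA ltr_pdivrMr// mul1r.
  by apply: lt_le_trans yM; rewrite /y; lra.
pose C := expR (- ((M + 1) `^ k) / k) / (M + 1).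
have C0 : 0 < C by rewrite divr_gt0 ?expR_gt0//; lra.
have : cvgn (series (fun n => C^-1 * `|kbinomial k c n * x ^+ n|)).
  exact: (is_cvg_seriesZ (k := C^-1) (@kbinomial_summable R k c x k0 kx)).
apply: series_le_cvg => n.
- exact: normr_ge0.
- by rewrite mulr_ge0// invr_ge0 ltW.
suff : `|term z n| <= C^-1 * `|kbinomial k c n * x ^+ n| by [].
have nX (w : R) : `|kbinomial k c n * w ^+ n| = `|kbinomial k c n| * `|w| ^+ n.
  by rewrite normrM normrX.
have xE : `|x| = `|z| / M `^ alpha by rewrite ger0_norm// divr_ge0 ?powR_ge0.
rewrite termE normrM normfV (gtr0_norm (G0 n)) !nX [leRHS]mulrC xE expr_div_n.
rewrite -[leLHS]mulrA -[leRHS]mulrA ler_wpM2l// -[leRHS]mulrA ler_wpM2l ?exprn_ge0//.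
rewrite -invfM lef_pV2 ?posrE// ?(mulr_gt0 (exprn_gt0 n Ma0) C0)//.
rewrite -powR_mulrn ?powR_ge0// -powRrM /G addrC.
by apply: kGamma_lower_bound => //; rewrite mulr_ge0// ltW.
Qed.

Definition mlKernel omega x : R :=
  x `^ (m / k - 1) / k * kMittagLeffler k alpha m c (omega * x `^ (alpha / k)).

(** Each power of x integrates to a value of the k-gamma function, which cancels
    the denominator of its coefficient and leaves a binomial series. *)
Theorem has_laplace_mlKernel omega p : 0 < p ->
  k * `|omega * (k * p) `^ (- (alpha / k))| < 1 ->
  has_laplace p (mlKernel omega) ((k * p) `^ (- (m / k)) *
    (1 - k * (omega * (k * p) `^ (- (alpha / k)))) `^ (- (c / k))).
Proof.
move=> p0; set x0 := omega * _ => kx0.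
have kp0 : 0 < k * p by rewrite mulr_gt0.
set W := (k * p) `^ (- (m / k)).
have W0 : 0 < W by exact: powR_gt0.
pose P n x := expR (- (p * x)) * x `^ ((alpha * n%:R + m) / k - 1).
pose A n := kbinomial k c n * omega ^+ n / (k * G n).
pose T n x := A n * P n x.
have P0 n x : 0 <= P n x by rewrite mulr_ge0 ?expR_ge0 ?powR_ge0.
pose D : set (measurableTypeR R) := `]0, +oo[%classic.
have mP n : measurable_fun D (P n).
  apply: measurable_halfline => x x1; apply: cvgM; first exact: continuous_expRNM.
  exact: continuous_powRl.
have mD : measurable D by exact: measurable_itv.
have intP n : (\int[leb]_(x in D) (P n x)%:E =
    (k * (k * p) `^ (- ((alpha * n%:R + m) / k)) * G n)%:E)%E.
  exact: integral_laplace_power_kGamma.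
have iP n : leb.-integrable D (EFin \o P n).
  apply/integrableP; split; first exact/measurable_EFinP.
  under eq_integral => x _ do rewrite /= ger0_norm//.
  by rewrite intP ltry.
have iT n : leb.-integrable D (EFin \o T n).
  rewrite (_ : EFin \o T n = (fun x => (A n)%:E * (EFin \o P n) x)%E)//.
  exact: integrableZl.
have coef n : A n * (k * (k * p) `^ (- ((alpha * n%:R + m) / k)) * G n) =
    W * (kbinomial k c n * x0 ^+ n).
  have -> : (k * p) `^ (- ((alpha * n%:R + m) / k)) =
      W * ((k * p) `^ (- (alpha / k))) ^+ n.
    rewrite -powR_mulrn ?powR_ge0// -powRrM /W -powRD; last first.
      by rewrite (gt_eqF kp0) implybT.
    by congr (_ `^ _); field; rewrite gt_eqF.
  rewrite /A /x0 exprMn; have := G0 n => Gn.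
  by field; rewrite !gt_eqF.
have normT n : (\int[leb]_(x in D) `|T n x|%:E =
    (W * `|kbinomial k c n * x0 ^+ n|)%:E)%E.
  under eq_integral => x _ do rewrite /T normrM (ger0_norm (P0 n x)) EFinM.
  rewrite ge0_integralZl_EFin//; last 2 first.
  - by move=> x _; rewrite lee_fin.
  - exact/measurable_EFinP.
  rewrite intP -EFinM; congr (_%:E).
  rewrite -(gtr0_norm W0) -normrM -coef.
  set B := k * _ * _.
  have B0 : 0 <= B by rewrite /B !mulr_ge0 ?powR_ge0// ltW.
  by rewrite -[in LHS](ger0_norm B0) -normrM.
have cu : cvgn (series (fun n => W * `|kbinomial k c n * x0 ^+ n|)).
  exact: (is_cvg_seriesZ (k := W) (@kbinomial_summable R k c x0 k0 kx0)).
have cf x : D x -> series (T ^~ x) n @[n --> \oo] -->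
    expR (- (p * x)) * mlKernel omega x.
  rewrite /D /= in_itv/= andbT => x1.
  have cv : series (term (omega * x `^ (alpha / k))) n @[n --> \oo] -->
      kMittagLeffler k alpha m c (omega * x `^ (alpha / k)).
    exact: kMittagLeffler_cvg.
  have : expR (- (p * x)) * (x `^ (m / k - 1) / k *
      series (term (omega * x `^ (alpha / k))) n) @[n --> \oo] -->
      expR (- (p * x)) * mlKernel omega x.
    by apply: cvgM; [exact: cvg_cst|apply: cvgM; [exact: cvg_cst|exact: cv]].
  apply: cvg_trans; apply: near_eq_cvg; apply: nearW => n.
  rewrite /series /= !mulr_sumr; apply: eq_bigr => i _.
  rewrite termE exprMn /T /P /A.
  have -> : (alpha * i%:R + m) / k - 1 = alpha / k * i%:R + (m / k - 1).
    by field; rewrite gt_eqF.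
  rewrite (@powRD _ x (alpha / k * i%:R)) ?(gt_eqF x1) ?implybT//.
  rewrite (@powRrM _ x (alpha / k)) powR_mulrn ?powR_ge0//.
  by have Gi := G0 i; field; rewrite !gt_eqF.
have [iK cK] := integral_series mD iT normT cu cf.
have mK := measurable_int _ iK.
split.
  apply/integrableP; split; first exact/emeasurable_fun_itv_obnd_cbndP.
  rewrite -integral_itv_obnd_cbnd; first by have /integrableP[] := iK.
  exact: measurableT_comp.
rewrite -Rintegral_itv_obnd_cbnd//.
apply: (cvg_unique _ cK) => //.
rewrite -(@kbinomial_series R k c x0 k0 kx0).
have -> : series (fun n => \int[leb]_(x in D) T n x) =
    (fun n => W * pseries (kbinomial k c) x0 n).
  apply/funext => n; rewrite /pseries /series /= mulr_sumr; apply: eq_bigr => i _.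
  by rewrite RintegralZl// /Rintegral intP/= coef.
apply: cvgM; first exact: cvg_cst.
by apply: normed_cvg; exact: kbinomial_summable.
Qed.

End MittagLefflerKernel.

(** * Laplace and Sumudu transforms on the half-line *)

Section HalfLineLaplace.
Variable R : realType.
Local Notation leb := (@lebesgue_measure R).
Implicit Types (a b : R -> R) (p X L : R).

Lemma has_laplace_integrable p a L X : 0 < p -> has_laplace p a L ->
  leb.-integrable `[0, X] (EFin \o a).
Proof.
move=> p0 [ia _].
have iaX : leb.-integrable `[0, X] (fun x => (expR (- (p * x)) * a x)%:E).
  apply: integrableS ia => //; apply: subset_itv; by rewrite bnd_simp.
have aE x : a x = expR (p * x) * (expR (- (p * x)) * a x).
  by rewrite mulrA -expRD subrr expR0 mul1r.
have mexp : measurable_fun (`[0, X] : set R) (fun x => expR (p * x)).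
  by apply: measurableT_comp => //; exact: measurable_funM.
have /integrableP[/measurable_EFinP mea _] := iaX.
have iE : leb.-integrable `[0, X]
    (fun x => (expR (p * X))%:E * (expR (- (p * x)) * a x)%:E)%E.
  exact: integrableZl.
apply: le_integrable iE => //.
  apply/measurable_EFinP.
  by have := measurable_funM mexp mea; congr measurable_fun; apply/funext => x /=.
move=> x; rewrite /= in_itv/= => /andP[x0 xX]; rewrite lee_fin {1}aE.
rewrite normrM [leRHS]normrM ler_wpM2r// !ger0_norm ?expR_ge0//.
by rewrite ler_expR ler_wpM2l// ltW.
Qed.

Let itvZ (r : R) a : leb.-integrable `[0, +oo[ (fun x => (a x)%:E) ->
  leb.-integrable `[0, +oo[ (fun x => (r * a x)%:E).
Proof.
move=> ia; rewrite (_ : (fun x => (r * a x)%:E) = (fun x => r%:E * (a x)%:E)%E)//.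
exact: integrableZl.
Qed.

Lemma has_laplace_cst1 p : 0 < p -> has_laplace p (fun=> 1) p^-1.
Proof.
move=> p0.
have E : (fun x => (p * (expR (- (p * x)) * 1))%:E) \_ `[0, +oo[ =
    EFin \o exponential_pdf p.
  apply/funext => x; rewrite /exponential_pdf /= !patchE; case: ifPn => // _.
  by rewrite mulr1 mulNr.
have I1 := integral_exponential_pdf p0; have I2 := integrable_exponential_pdf p0.
have i1 : leb.-integrable `[0, +oo[ (fun x => (p * (expR (- (p * x)) * 1))%:E).
  by rewrite integrable_mkcond// E.
have i2 : leb.-integrable `[0, +oo[ (fun x => (expR (- (p * x)) * 1)%:E).
  have := itvZ p^-1 i1; apply: eq_integrable => // x _.
  by rewrite mulKf ?gt_eqF.
split => //; apply: (mulfI (lt0r_neq0 p0)); rewrite -RintegralZl// divff ?gt_eqF//.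
rewrite /Rintegral integral_mkcond E.
by have -> : (\int[leb]_x (EFin \o exponential_pdf p) x = 1)%E by exact: I1.
Qed.

Lemma has_laplace_scale p a L (r : R) :
  has_laplace p a L -> has_laplace p (fun x => r * a x) (r * L).
Proof.
move=> [ia <-]; split.
  have := itvZ r ia; apply: eq_integrable => // x _.
  by rewrite mulrCA.
by rewrite -RintegralZl//; apply: eq_Rintegral => x _; rewrite mulrCA.
Qed.

Lemma has_laplace_sub p a b La Lb : has_laplace p a La -> has_laplace p b Lb ->
  has_laplace p (fun x => a x - b x) (La - Lb).
Proof.
move=> [ia <-] [ib <-]; split.
  rewrite (_ : (fun x => _) = (fun x => (expR (- (p * x)) * a x)%:E) \-
      (fun x => (expR (- (p * x)) * b x)%:E))%E; first exact: integrableB.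
  by apply/funext => x; rewrite mulrBr.
by rewrite -RintegralB//; apply: eq_Rintegral => x _; rewrite mulrBr.
Qed.

Lemma has_laplace_unique p a b La Lb : has_laplace p a La -> has_laplace p b Lb ->
  (forall x, 0 <= x -> a x = b x) -> La = Lb.
Proof.
move=> [_ <-] [_ <-] ab; apply: eq_Rintegral => x.
by rewrite inE/= in_itv/= andbT => /ab ->.
Qed.

(** A primitive is a Volterra integral with kernel 1. *)
Lemma has_laplace_primitive p a L : 0 < p -> has_laplace p a L ->
  has_laplace p (primitive a) (p^-1 * L).
Proof.
move=> p0 ha; have := has_laplace_volterra (has_laplace_cst1 p0) ha.
congr has_laplace; apply/funext => x; apply: eq_Rintegral => t _.
by rewrite mul1r.
Qed.

Lemma has_laplace_sumudu f (u : R) : 0 < u -> sumudu_exists f u ->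
  exists2 L, has_laplace u^-1 f L & sumudu f u = u^-1 * L.
Proof.
move=> u0 ef.
have i : leb.-integrable `[0, +oo[ (fun x => (expR (- (u^-1 * x)) * f x)%:E).
  have := itvZ u ef; apply: eq_integrable => // t _.
  congr (_%:E); rewrite (_ : - t / u = - (u^-1 * t)); last by ring.
  by rewrite -mulrA mulVKf ?gt_eqF.
exists (\int[leb]_(x in `[0, +oo[) (expR (- (u^-1 * x)) * f x)) => //.
rewrite /sumudu -RintegralZl//; apply: eq_Rintegral => t _.
by rewrite mulrA; congr (_ * expR _ * _); ring.
Qed.

End HalfLineLaplace.

(** * Prabhakar operators *)

Section PrabhakarOperator.
Variable R : realType.
Local Notation leb := (@lebesgue_measure R).
Variables (k alpha omega p : R).
Hypotheses (k0 : 0 < k) (alpha0 : 0 < alpha) (p0 : 0 < p).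

Let q := k * (omega * (k * p) `^ (- (alpha / k))).

Hypothesis q1 : `|q| < 1.

Let kq : k * `|omega * (k * p) `^ (- (alpha / k))| < 1.
Proof. by move: q1; rewrite /q normrM gtr0_norm. Qed.

Lemma kPrabhakar_volterra (m c : R) (h : R -> R) : m != 0 ->
  kPrabhakar k alpha m omega c h = volterra (mlKernel k alpha m c omega) h.
Proof. by move=> /negPf m0; apply/funext => x; rewrite /kPrabhakar m0. Qed.

Lemma ae_eq_kPrabhakar (m c : R) (h h' : R -> R) (X : R) : ae_eq leb `[0, X]%classic h h' ->
  ae_eq leb `[0, X]%classic (kPrabhakar k alpha m omega c h)
    (kPrabhakar k alpha m omega c h').
Proof.
move=> hh; have [mc|mc] := boolP ((m == 0) && (c == 0)).
  by rewrite /kPrabhakar mc.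
apply: aeW => x; rewrite /= in_itv/= => /andP[_ xX].
rewrite /kPrabhakar (negPf mc); congr fine; apply: ae_eq_integral_set.
move: hh => [N [mN N0 sub]]; exists N; split => // t /= hn; apply: sub => /= ht.
apply: hn; rewrite /= in_itv/= => /andP[t0 tx]; rewrite ht//= in_itv/= t0.
exact: le_trans xX.
Qed.

(** The Laplace transform of the kernel; it is 1 for [m = c = 0], where the
    operator is the identity. *)
Definition prabhakar_symbol (m c : R) : R :=
  (k * p) `^ (- (m / k)) * (1 - q) `^ (- (c / k)).

(** [T] is the operator itself: the identity for [m = 0], and otherwise the
    convolution with the kernel in the other order. It acts on primitives because
    integration commutes with convolution. *)
Lemma kPrabhakar_transfer (m c : R) : 0 <= m -> (m = 0 -> c = 0) ->
  exists T : (R -> R) -> R -> R,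
  [/\ forall (h : R -> R) (X : R), leb.-integrable `[0, X] (EFin \o h) ->
        leb.-integrable `[0, X] (EFin \o kPrabhakar k alpha m omega c h) /\
        forall x, x <= X ->
          primitive (kPrabhakar k alpha m omega c h) x = T (primitive h) x,
      forall (f g : R -> R) (x : R), (forall y : R, 0 <= y <= x -> f y = g y) -> 0 <= x -> T f x = T g x &
      forall f L, has_laplace p f L ->
        has_laplace p (T f) (prabhakar_symbol m c * L)].
Proof.
move=> m_ge0 mc; have [m0|m0] := eqVneq m 0.
  exists id; split.
  - move=> h X ih; have -> : kPrabhakar k alpha m omega c h = h.
      by apply/funext => x; rewrite /kPrabhakar m0 (mc m0) eqxx.
    by split.
  - by move=> f g x fg x0; apply: fg; rewrite x0 lexx.
  - move=> f L; rewrite /prabhakar_symbol (mc m0) m0 !mul0r oppr0 !powRr0.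
    by rewrite !mul1r.
have m1 : 0 < m by rewrite lt_neqAle eq_sym m0.
have HK := has_laplace_mlKernel c k0 alpha0 m1 p0 kq.
exists (fun f => volterra f (mlKernel k alpha m c omega)); split.
- move=> h X ih; rewrite kPrabhakar_volterra//.
  have iK := has_laplace_integrable X p0 HK.
  split; first exact: volterra_integrable.
  by move=> x xX; rewrite (primitive_volterra xX).
- by move=> f g x fg _; apply: eq_volterra.
- by move=> f L hf; rewrite mulrC; exact: has_laplace_volterra.
Qed.

End PrabhakarOperator.

(** * The regularized Hilfer-Prabhakar derivative *)

Lemma absolutely_continuous_right_lim (R : realType) (b : R) (f : R -> R) : 0 < b ->
  absolutely_continuous 0 b f -> lim (f x @[x --> 0^'+]) = f 0.
Proof.
move=> b0 /absolutely_continuous_family ac; apply/cvg_lim => //.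
apply/cvgrPdist_le => e e0; have [d d0 Hd] := ac e e0.
near=> t.
have t0 : 0 < t by near: t; exact: nbhs_right_gt.
have td : t < d by near: t; exact: nbhs_right_lt.
have tb : t <= b by near: t; exact: nbhs_right_le.
have := Hd [:: (0, t)]; rewrite interval_family1 lexx t0 tb.
by rewrite /total_length /oscillation !big_seq1/= subr0 distrC; exact.
Unshelve. all: by end_near. Qed.

Lemma absolutely_continuous_halfline_derivative (R : realType) (f : R -> R) (X : R) :
  0 < X -> (forall b, 0 < b -> absolutely_continuous 0 b f) ->
  exists h : R -> R,
  [/\ (@lebesgue_measure R).-integrable `[0, X] (EFin \o h),
      forall x, 0 <= x <= X -> primitive h x = f x - f 0 &
      ae_eq (@lebesgue_measure R) `[0, X]%classic (derive1 f) h].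
Proof.
(* On [0, X + 1] the point X is interior, and only 0 has to be excluded. *)
move=> X0 ac; have X1 : 0 < X + 1 by rewrite ltr_wpDr.
have [h [ih hE hd]] := absolutely_continuous_FTC (ltW X1) (ac _ X1).
exists h; split.
- exact: integrableS ih.
- move=> x /andP[x0 xX]; rewrite hE; last by rewrite x0; lra.
  by rewrite Rintegral_itv_obnd_cbnd//; exact: integrableS ih.
have [N [mN N0 sub]] := hd.
exists (N `|` [set 0]); split.
- by apply: measurableU => //; exact: measurable_set1.
- by rewrite measureU0//; exact: lebesgue_measure_set1.
move=> x /= hx; have [->|xn0] := eqVneq x 0; [by right|left; apply: sub => /= hd'].
apply: hx; rewrite /= in_itv/= => /andP[x0 xX]; apply: hd'.
by rewrite lt_neqAle eq_sym xn0 x0; lra.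
Qed.

Lemma primitive_ae_scale (R : realType) (r X x : R) (g h : R -> R) : x <= X ->
  ae_eq (@lebesgue_measure R) `[0, X]%classic g h ->
  (@lebesgue_measure R).-integrable `[0, X] (EFin \o h) ->
  primitive (fun t => r * g t) x = r * primitive h x.
Proof.
move=> xX [N [mN N0 sub]] ih.
have ihx : (@lebesgue_measure R).-integrable `[0, x] (EFin \o h).
  by apply: integrableS ih => //; apply: subset_itvl; rewrite bnd_simp.
rewrite /primitive -RintegralZl// /Rintegral; congr fine.
apply: ae_eq_integral_set; exists N; split => // t /= ht; apply: sub => /= ht'.
apply: ht => /= txx; rewrite ht'//.
by move: txx; rewrite /= !in_itv/= => /andP[->/=] tx; exact: le_trans xX.
Qed.

Theorem lemma3p9 (R : realType) (k alpha gamma omega mu nu : R) (f : R -> R)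
    (k_gt0 : 0 < k) (alpha_gt0 : 0 < alpha)
    (mu_gt0 : 0 < mu) (mu_lt1 : mu < 1) (mu_ltk : mu < k)
    (nu_ge0 : 0 <= nu) (nu_le1 : nu <= 1)
    (f_AC : forall b : R, 0 < b -> absolutely_continuous 0 b f)
    (u : R) (u_gt0 : 0 < u)
    (f_sumudu : sumudu_exists f u)
    (Df_sumudu :
      sumudu_exists (kHilferPrabhakar k alpha omega gamma mu nu f) u)
    (u_small : `|omega * k * (u / k) `^ (alpha / k)| < 1) :
  sumudu (kHilferPrabhakar k alpha omega gamma mu nu f) u =
  (u / k) `^ (- (mu / k)) *
  (1 - omega * k * (u / k) `^ (alpha / k)) `^ (gamma / k) *
  (sumudu f u - lim (f x @[x --> 0^'+])).
Proof.
rewrite (absolutely_continuous_right_lim ltr01 (f_AC _ ltr01)).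
set D := kHilferPrabhakar _ _ _ _ _ _ _ in Df_sumudu *.
have p0 : 0 < u^-1 by rewrite invr_gt0.
have [Lf hf ->] := has_laplace_sumudu u_gt0 f_sumudu.
have [LD hD ->] := has_laplace_sumudu u_gt0 Df_sumudu.
set p := u^-1 in p0 hf hD *.
have kpE a : (k * p) `^ (- a) = (u / k) `^ a.
  rewrite -[in RHS](invrK (u / k)) invf_div -[_^-1]powR_inv1.
    by rewrite -powRrM mulN1r mulrC.
  by rewrite divr_ge0 ?ltW.
have qE : k * (omega * (k * p) `^ (- (alpha / k))) =
    omega * k * (u / k) `^ (alpha / k) by rewrite kpE; ring.
have q1 : `|k * (omega * (k * p) `^ (- (alpha / k)))| < 1 by rewrite qE.
pose S := prabhakar_symbol k alpha omega p.
have m1 : 0 <= nu * (k - mu) by rewrite mulr_ge0// subr_ge0 ltW.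
have m2 : 0 <= (1 - nu) * (k - mu) by rewrite mulr_ge0// subr_ge0// ltW.
have kmu : k - mu != 0 by rewrite subr_eq0 gt_eqF.
have c1 : nu * (k - mu) = 0 -> - (gamma * nu) = 0.
  by move=> /eqP; rewrite mulf_eq0 (negPf kmu) orbF => /eqP ->; rewrite mulr0 oppr0.
have c2 : (1 - nu) * (k - mu) = 0 -> - (gamma * (1 - nu)) = 0.
  by move=> /eqP; rewrite mulf_eq0 (negPf kmu) orbF => /eqP ->; rewrite mulr0 oppr0.
have [T1 [T1P T1loc T1L]] := kPrabhakar_transfer k_gt0 alpha_gt0 p0 q1 m1 c1.
have [T2 [T2P T2loc T2L]] := kPrabhakar_transfer k_gt0 alpha_gt0 p0 q1 m2 c2.
pose phi x := f x - f 0 * 1.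
(* The integrated form of the definition of the derivative. *)
have DE x : 0 <= x -> primitive D x = k * T1 (T2 phi) x.
  move=> x0; have X0 : 0 < x + 1 by rewrite ltr_wpDl.
  have xX : x <= x + 1 by rewrite lerDl.
  have [h [ih hE hd]] := absolutely_continuous_halfline_derivative X0 f_AC.
  have [i2 E2] := T2P h _ ih.
  have [i1 E1] := T1P _ _ i2.
  have dd := ae_eq_kPrabhakar k alpha omega (nu * (k - mu)) (- (gamma * nu))
    (ae_eq_kPrabhakar k alpha omega ((1 - nu) * (k - mu)) (- (gamma * (1 - nu))) hd).
  set PPh := kPrabhakar k alpha (nu * (k - mu)) omega _ (kPrabhakar _ _ _ _ _ h)
    in dd i1 E1.
  transitivity (k * primitive PPh x).
    exact: primitive_ae_scale k _ _ _ _ xX dd i1.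
  rewrite E1//; congr (_ * _); apply: T1loc => // y /andP[y0 yx].
  rewrite E2 ?(le_trans yx xX)//; apply: T2loc => // z /andP[z0 zy].
  by rewrite hE /phi ?mulr1// z0 (le_trans zy)// (le_trans yx).
have h1 := has_laplace_scale (f 0) (has_laplace_cst1 p0).
have h2 := T1L _ _ (T2L _ _ (has_laplace_sub hf h1)).
have LE := has_laplace_unique (has_laplace_primitive p0 hD) (has_laplace_scale k h2) DE.
have p_neq0 := lt0r_neq0 p0.
have -> : LD = p * (k * (S (nu * (k - mu)) (- (gamma * nu)) *
    (S ((1 - nu) * (k - mu)) (- (gamma * (1 - nu))) * (Lf - f 0 * p^-1)))).
  by rewrite -LE mulVKf.
have -> : p * Lf - f 0 = p * (Lf - f 0 * p^-1) by field.
rewrite /S /prabhakar_symbol qE !kpE.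
set Q := 1 - omega * k * _; set r := u / k.
have Q0 : 0 < Q by rewrite subr_gt0; apply: le_lt_trans u_small; exact: ler_norm.
have r0 : 0 < r by rewrite divr_gt0.
have EQ : Q `^ (- (- (gamma * nu) / k)) * Q `^ (- (- (gamma * (1 - nu)) / k)) =
    Q `^ (gamma / k).
  rewrite -powRD ?(gt_eqF Q0) ?implybT//; congr (_ `^ _); field.
  by rewrite gt_eqF.
have Er : p * k * (r `^ (nu * (k - mu) / k) * r `^ ((1 - nu) * (k - mu) / k)) =
    r `^ (- (mu / k)).
  have -> : p * k = r `^ (- 1) by rewrite powR_inv1 ?ltW// /r /p invf_div mulrC.
  rewrite -!powRD ?(gt_eqF r0) ?implybT//; congr (_ `^ _); field.
  by rewrite gt_eqF.
by rewrite -EQ -Er; ring.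
Qed.
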